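(* Let $n\ge1$, $q=2^n$, and let $G=\mathrm{PSL}(2,2^n)$ act on the $13$-subsets of $X=\mathrm{GF}(2^n)\cup\{\infty\}$. Put \[W_n=\frac{1}{23040}q(q-2)(q-4)(q-8)(q-16).\] Then \[m_{858}=\begin{cases}W_n-1 & \text{if } n\equiv 6,10,12,18,20,24,36,40,42,48,50,54\pmod{60},\\ W_n-2 & \text{if } n\equiv 0,30\pmod{60},\\ W_n & \text{otherwise}.\end{cases}\]
   Context: $\mathrm{PSL}(2,2^n)$ is the group of all maps $X\to X$, $x\mapsto\frac{ax+b}{cx+d}$ with $a,b,c,d\in\mathrm{GF}(2^n)$, $ad-bc\neq0$ (usual conventions for $\infty$). For a $13$-subset $B$ of $X$, $G_B=\{g\in G: g(B)=B\}$ and $G(B)=\{g(B):g\in G\}$. Each orbit $G(B)$ is a simple $3$-$(2^n+1,13,\lambda_B)$ design (every $3$-subset of $X$ lies in exactly $\lambda_B$ members of $G(B)$), with $\lambda_B=1716/|G_B|$. $m_\lambda$ denotes the number of $G$-orbits $G(B)$ of $13$-subsets with $\lambda_B=\lambda$; so $m_{858}$ counts the orbits with $|G_B|=2$. *)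

(* Defs.v *)
From mathcomp Require Import all_boot all_order all_algebra all_fingroup.
From mathcomp Require Import ring.

Set Implicit Arguments.
Unset Strict Implicit.
Unset Printing Implicit Defensive.

Import Order.TTheory GRing.Theory Num.Theory.
Local Open Scope ring_scope.

(* The projective line F ∪ {∞} is [option F], with [None] as ∞. *)
Definition mobius (F : fieldType) (a b c d : F) (x : option F) : option F :=
  match x with
  | None => if c == 0 then None else Some (a / c)
  | Some x => if c * x + d == 0 then None else Some ((a * x + b) / (c * x + d))
  end.

Lemma mobius_comp (F : fieldType) (a b c d a' b' c' d' : F) x :
  a * d - b * c != 0 -> a' * d' - b' * c' != 0 ->
  mobius a' b' c' d' (mobius a b c d x) =
  mobius (a' * a + b' * c) (a' * b + b' * d)
         (c' * a + d' * c) (c' * b + d' * d) x.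
Proof.
move=> D0 D0'.
(* x = u / v in homogeneous coordinates *)
have key u v : (u != 0) || (v != 0) ->
  (if v == 0 then if c' == 0 then None else Some (a' / c')
   else if c' * (u / v) + d' == 0 then None
        else Some ((a' * (u / v) + b') / (c' * (u / v) + d'))) =
  (if c' * u + d' * v == 0 then None
   else Some ((a' * u + b' * v) / (c' * u + d' * v))).
  have [->|v0] := eqVneq v 0; rewrite ?orbF => uv.
    rewrite !mulr0 !addr0 mulf_eq0 (negPf uv) orbF.
    by case: eqVneq => // c0; congr Some; field; rewrite c0 uv.
  have e : c' * (u / v) + d' = (c' * u + d' * v) / v by field.
  rewrite e mulf_eq0 invr_eq0 (negPf v0) orbF.
  by case: eqVneq => // c0; congr Some; field; rewrite c0 v0.
case: x => [x|] /=.
  have := key (a * x + b) (c * x + d).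
  have -> : c' * (a * x + b) + d' * (c * x + d) =
            (c' * a + d' * c) * x + (c' * b + d' * d) by ring.
  have -> : a' * (a * x + b) + b' * (c * x + d) =
            (a' * a + b' * c) * x + (a' * b + b' * d) by ring.
  move=> <-; first by case: ifP.
  rewrite -negb_and; apply: contraNN D0 => /andP[/eqP e1 /eqP e2].
  have [c0|c0] := eqVneq c 0.
    by move: e2; rewrite c0 mul0r add0r => ->; rewrite !mulr0 subr0.
  have -> : a * d - b * c = a * (c * x + d) - c * (a * x + b) by ring.
  by rewrite e1 e2 !mulr0 subr0.
rewrite -(key a c); first by case: ifP.
rewrite -negb_and; apply: contraNN D0 => /andP[/eqP-> /eqP->].
by rewrite mul0r mulr0 subr0.
Qed.

Lemma mobius_scalar (F : fieldType) (e : F) x :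
  e != 0 -> mobius e 0 0 e x = x.
Proof.
move=> e0; case: x => [x|] /=; last by rewrite eqxx.
by rewrite mul0r add0r (negPf e0) addr0 mulrC mulKf.
Qed.

(* So PSL2_set, being a set of permutations, still contains every such map. *)
Lemma mobius_inj (F : fieldType) (a b c d : F) :
  a * d - b * c != 0 -> injective (mobius a b c d).
Proof.
move=> D0; apply: (can_inj (g := mobius d (- b) (- c) a)) => x.
have D0' : d * a - (- b) * (- c) != 0 by rewrite mulrNN mulrC.
rewrite (mobius_comp _ D0 D0').
have -> : d * b + - b * d = 0 by ring.
have -> : - c * a + a * c = 0 by ring.
have -> : d * a + - b * c = a * d - b * c by ring.
have -> : - c * b + a * d = a * d - b * c by ring.
exact: mobius_scalar.
Qed.

(* All maps with nonzero determinant: this is PGL(2, F), which equals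
   PSL(2, F) when F has characteristic 2. *)
Definition PSL2_set (F : finFieldType) : {set {perm (option F)}} :=
  [set s : {perm (option F)} |
    [exists a : F, exists b : F, exists c : F, exists d : F,
      (a * d - b * c != 0) && [forall x, s x == mobius a b c d x]]].

Lemma PSL2P (F : finFieldType) (s : {perm (option F)}) :
  reflect (exists a b c d : F, a * d - b * c != 0 /\ s =1 mobius a b c d)
          (s \in PSL2_set F).
Proof.
rewrite inE; apply: (iffP existsP) => [[a] | [a [b [c [d [D0 e]]]]]].
  move=> /existsP[b /existsP[c /existsP[d /andP[D0 /forallP e]]]].
  by exists a, b, c, d; split=> // x; apply/eqP.
exists a; apply/existsP; exists b; apply/existsP; exists c; apply/existsP.
by exists d; rewrite D0; apply/forallP => x; rewrite e.
Qed.

Lemma PSL2_group_set (F : finFieldType) : group_set (PSL2_set F).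
Proof.
apply/group_setP; split.
  apply/PSL2P; exists 1, 0, 0, 1; split=> [|x].
    by rewrite mulr1 mulr0 subr0 oner_neq0.
  by rewrite perm1 mobius_scalar ?oner_neq0.
move=> s t /PSL2P[a [b [c [d [D0 es]]]]] /PSL2P[a' [b' [c' [d' [D0' et]]]]].
apply/PSL2P; exists (a' * a + b' * c), (a' * b + b' * d),
  (c' * a + d' * c), (c' * b + d' * d); split=> [|x].
  have -> : (a' * a + b' * c) * (c' * b + d' * d)
          - (a' * b + b' * d) * (c' * a + d' * c)
          = (a' * d' - b' * c') * (a * d - b * c) by ring.
  by rewrite mulf_neq0.
by rewrite permM es et mobius_comp.
Qed.

Definition PSL2 (F : finFieldType) : {group {perm (option F)}} :=
  Group (PSL2_group_set F).

(* Simple t-(v, k, lambda) design on the point set T, with block set D. *)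
Definition is_design (T : finType) (t v k lambda : nat) (D : {set {set T}}) :=
  [&& #|T| == v,
      [forall B in D, #|B| == k] &
      [forall A : {set T}, (#|A| == t) ==>
         (#|[set B in D | A \subset B]| == lambda)]].

(* [orbit 'P^* (PSL2 F) B] is { g(B) : g in PSL2 F }. *)
Definition orbits13 (F : finFieldType) : {set {set {set (option F)}}} :=
  [set orbit ('P^*)%act (PSL2 F) B | B : {set (option F)} & #|B| == 13%N].

Definition m_ (F : finFieldType) (lambda : nat) : nat :=
  #|[set O in orbits13 F | is_design 3 #|F|.+1 13 lambda O]|.

Definition W (n : nat) : rat :=
  let q : rat := 2 ^+ n in
  1 / 23040 * q * (q - 2) * (q - 4) * (q - 8) * (q - 16).

(* Main.v *)
Require Import Defs.
From mathcomp Require Import all_boot all_order all_algebra all_fingroup.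
From mathcomp Require Import cyclic finfield closed_field ring.

Set Implicit Arguments.
Unset Strict Implicit.
Unset Printing Implicit Defensive.

Import Order.TTheory GRing.Theory Num.Theory.

(** The group G acts sharply 3-transitively, so counting the elements g for
    which g(B) contains a given 3-subset shows that lambda_B * |G_B| = 1716;
    the orbits to be counted are those with |G_B| = 2 ([orbit_is_design]).

    All involutions of G are conjugate to t : x |-> x + 1, whose centralizer is
    the group of the q translations.  Each orbit with |G_B| = 2 therefore
    contains exactly q / 2 blocks with G_B = <t> ([design_orbits_blocks]), and
    it is enough to count those blocks.  A block fixed by t consists of oo and
    of six pairs {x, x + 1}, so it is given by a 6-subset C of the image Q of
    the Artin-Schreier map phi x = x^2 + x; there are 'C(q / 2, 6) choices of C.
    From these one removes the C for which G_B is larger than <t>.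

    - If G_B contains a second translation, then C is invariant under a nonzero
      shift e in Q.  Such a C determines e, being three pairs of sum e, and
      'C(q / 4, 3) sets C belong to each e ([card_invariant_sixsets]).
    - Otherwise t is its own centralizer in H = G_B.  Then H is the union of an
      abelian group K inverted by t and of the class of t
      ([self_centralizing_involution]).  The block splits into the K-orbit of
      oo, at most two common fixed points of K, and regular orbits of H, which
      leaves #|K| = 13 or #|K| = 11 ([stab_asymmetric]).  The elements of K have
      matrices ((r + 1, d), (1, r)) with one and the same d, and their powers
      are governed by Fibonacci polynomials; so C is a translate of the set of
      roots of fib _ 13 (degree 6), or of the roots of fib _ 11 (degree 5)
      together with 0.  Conversely such translates have dihedral symmetry
      ([stab_symmetric]).

    The roots of fib _ 13 have degree 6 over GF(2) and lie in one coset of Q;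
    they contribute q / 2 sets if 6 divides n and none otherwise.  The roots of
    fib _ 11 have degree 5, and they lie in Q exactly if 10 divides n; they
    contribute q / 2 sets in that case and none otherwise.  The resulting
    equation ([orbit_equation]) is solved for the number of orbits. *)

(** * Involutions that are their own centralizer *)

Section SelfCentralizingInvolution.

Local Open Scope group_scope.

Variables (gT : finGroupType) (H : {group gT}) (t : gT).
Hypotheses (tH : t \in H) (ot : #[t] = 2) (centt : 'C_H[t] = <[t]>).

Lemma invol_class s : s \in t ^: H -> [/\ s \in H, #[s] = 2 & 'C_H[s] = <[s]>].
Proof.
case/imsetP=> h hH ->; rewrite orderJ groupJ //; split=> //.
by rewrite -{1}(conjGid hH) cent1J -conjIg centt cycleJ.
Qed.

Lemma invg_order2 (s : gT) : #[s] = 2 -> s^-1 = s.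
Proof.
by move=> os; apply/eqP; rewrite eq_invg_mul -[s * s]/(s ^+ 2) -os expg_order.
Qed.

Lemma mem_cycle2 (s x : gT) : #[s] = 2 -> (x \in <[s]>) = (x == 1) || (x == s).
Proof.
move=> os; apply/idP/orP; last by case=> /eqP->; rewrite ?group1 ?cycle_id.
move=> /cyclePmin[i]; rewrite os; case: i => [|[|//]] _ ->.
  by left; rewrite expg0.
by right; rewrite expg1.
Qed.

Lemma card_invol_class : #|H| = (2 * #|t ^: H|)%N.
Proof.
have ccent : #|'C_H[t]| = 2 by rewrite centt.
by rewrite -index_cent1 -ccent Lagrange ?subsetIl.
Qed.

(** If a product of s with a conjugate x of t were again conjugate to t, then s
    and x would be commuting involutions, hence equal, with product 1.  So the
    coset avoids the class of t, and both halves of H have the same size. *)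
Lemma invol_coset s : s \in t ^: H -> s *: (t ^: H) = H :\: t ^: H.
Proof.
move=> sI; have [sH os cs] := invol_class sI.
have subH : t ^: H \subset H by apply/subsetP=> x /invol_class[].
apply/eqP; rewrite eqEcard; apply/andP; split; last first.
  rewrite card_lcoset cardsD (setIidPr subH) card_invol_class.
  by rewrite mul2n -addnn addnK.
apply/subsetP=> _ /lcosetP[x xI ->]; have [xH ox _] := invol_class xI.
rewrite inE groupM // andbT; apply/negP=> /invol_class[_ osx _].
have sx : commute s x by rewrite /commute -{1}(invg_order2 osx) invMg !invg_order2.
have: x \in 'C_H[s] by rewrite inE xH; apply/cent1P.
rewrite cs mem_cycle2 // => /orP[] /eqP ex.
  by move: ox; rewrite ex order1.
by move: osx; rewrite ex -{2}(invg_order2 os) mulgV order1.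
Qed.

Lemma invol_inverts s k : s \in t ^: H -> k \in H :\: t ^: H -> k ^ s = k^-1.
Proof.
move=> sI; rewrite -(invol_coset sI) => /lcosetP[x xI ->].
have [[sH os _] [xH ox _]] := (invol_class sI, invol_class xI).
by rewrite invMg conjgE -mulgA mulKg !invg_order2.
Qed.

(** A product of two conjugates of t is inverted by every conjugate of t, hence
    centralized by every such product.  This makes the complement of the class
    of t an abelian subgroup: the Frobenius kernel, for a complement of order 2. *)
Lemma self_centralizing_involution : exists K : {group gT},
  [/\ abelian K, K \subset H :\ t, #|H| = (2 * #|K|)%N,
      forall k, k \in K -> k ^ t = k^-1 &
      forall h, h \in H -> h \notin K -> h \in t ^: H /\ t * h \in K].
Proof.
have tI : t \in t ^: H by apply: class_refl.
have comm k l : k \in H :\: t ^: H -> l \in H :\: t ^: H -> commute k l.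
  move=> kK; rewrite -(invol_coset tI) => /lcosetP[x xI ->].
  apply/commgP/conjg_fixP; rewrite conjgM (invol_inverts tI) //.
  by rewrite conjVg (invol_inverts xI) ?invgK.
have subH : t ^: H \subset H by apply/subsetP=> x /invol_class[].
have gK : group_set (H :\: t ^: H).
  apply/group_setP; split=> [|k l kK lK].
    by rewrite inE group1 andbT; apply/negP=> /invol_class[_]; rewrite order1.
  rewrite inE groupM ?(subsetP (subsetDl _ _) _ kK, subsetP (subsetDl _ _) _ lK) //.
  rewrite andbT; apply/negP=> klI; have [_ okl ckl] := invol_class klI.
  have ck : commute k (k * l).
    by apply: commuteM => //; apply: comm.
  have: k \in 'C_H[k * l].
    by rewrite inE (subsetP (subsetDl _ _) _ kK); apply/cent1P.
  rewrite ckl mem_cycle2 // => /orP[] /eqP ek.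
    by move: klI lK; rewrite ek mul1g inE => ->.
  by move: klI kK; rewrite -ek inE => ->.
exists (Group gK); split=> /=.
- by apply/centsP=> k kK l lK; apply: comm.
- apply/subsetP=> k /setDP[kH kI]; rewrite !inE kH andbT.
  by apply: contraNneq kI => ->.
- by rewrite -(invol_coset tI) card_lcoset card_invol_class.
- by move=> k kK; apply: invol_inverts.
move=> h hH; rewrite inE hH andbT negbK => hI; split=> //.
by rewrite -(invol_coset tI) mem_lcoset mulKg.
Qed.

End SelfCentralizingInvolution.

Local Open Scope ring_scope.

(** * Identities in characteristic 2 *)

Lemma natr_pchar2 (R : nzRingType) (R2 : 2 \in [pchar R]) n :
  n%:R = (odd n)%:R :> R.
Proof.
rewrite -{1}(odd_double_half n) natrD -mul2n natrM (pcharf0 R2).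
by rewrite mul0r addr0.
Qed.

Lemma oppr1_pchar2 (R : nzRingType) (R2 : 2 \in [pchar R]) : - 1 = 1 :> R.
Proof. exact: oppr_pchar2. Qed.

(** The tactic [ring] normalizes over the integers; the listed equations reduce
    modulo 2 the coefficients that occur below. *)
Ltac ring2 F2 := ring:
  (natr_pchar2 F2 2 : 2%:R = 0)
  (natr_pchar2 F2 3 : 3%:R = 1)
  (natr_pchar2 F2 4 : 4%:R = 0)
  (natr_pchar2 F2 5 : 5%:R = 1)
  (natr_pchar2 F2 6 : 6%:R = 0)
  (natr_pchar2 F2 7 : 7%:R = 1)
  (natr_pchar2 F2 8 : 8%:R = 0)
  (natr_pchar2 F2 9 : 9%:R = 1)
  (natr_pchar2 F2 10 : 10%:R = 0)
  (natr_pchar2 F2 11 : 11%:R = 1)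
  (natr_pchar2 F2 12 : 12%:R = 0)
  (natr_pchar2 F2 13 : 13%:R = 1)
  (natr_pchar2 F2 14 : 14%:R = 0)
  (natr_pchar2 F2 15 : 15%:R = 1)
  (natr_pchar2 F2 16 : 16%:R = 0)
  (natr_pchar2 F2 20 : 20%:R = 0)
  (oppr1_pchar2 F2).

(** The Fibonacci polynomials.  If w = z^2 + z in characteristic 2, then
    fib w m = z^m + (z + 1)^m, so for odd m the roots of fib _ m correspond to
    the pairs {zeta, 1 / zeta} of nontrivial m-th roots of unity, with
    zeta = (z + 1) / z. *)
Fixpoint fib (R : nzRingType) (w : R) (m : nat) : R :=
  match m with
  | 0 => 0
  | 1 => 1
  | (p.+1 as k).+1 => fib w k + w * fib w p
  end.

Lemma fib11 (R : comNzRingType) (R2 : 2 \in [pchar R]) (w : R) :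
  fib w 11 = w ^+ 5 + w ^+ 4 + w ^+ 3 + w + 1.
Proof.
rewrite /fib; ring: (natr_pchar2 R2 9 : 9%:R = 1) (natr_pchar2 R2 28 : 28%:R = 0)
  (natr_pchar2 R2 35 : 35%:R = 1) (natr_pchar2 R2 15 : 15%:R = 1).
Qed.

Lemma fib13 (R : comNzRingType) (R2 : 2 \in [pchar R]) (w : R) :
  fib w 13 = w ^+ 6 + w ^+ 5 + w ^+ 2 + w + 1.
Proof.
rewrite /fib; ring: (natr_pchar2 R2 11 : 11%:R = 1) (natr_pchar2 R2 45 : 45%:R = 1)
  (natr_pchar2 R2 84 : 84%:R = 0) (natr_pchar2 R2 70 : 70%:R = 0)
  (natr_pchar2 R2 21 : 21%:R = 1).
Qed.

(** * Elements of PSL(2, F) in characteristic 2 *)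

Section Mobius.

Variables (F : finFieldType) (F2 : 2 \in [pchar F]).
Local Notation G := (PSL2 F).
Local Notation oo := (@None F).

Definition mobius_perm (a b c d : F) (D : a * d - b * c != 0) : {perm option F} :=
  perm (mobius_inj D).

Lemma mobius_permE a b c d (D : a * d - b * c != 0) :
  mobius_perm D =1 mobius a b c d.
Proof. exact: permE. Qed.

Lemma mobius_perm_PSL2 a b c d (D : a * d - b * c != 0) : mobius_perm D \in G.
Proof. by apply/PSL2P; exists a, b, c, d; split=> // x; rewrite mobius_permE. Qed.

Lemma translation_det (u : F) : 1 * 1 - u * 0 != 0.
Proof. by rewrite mulr0 subr0 mulr1 oner_neq0. Qed.

Definition translation (u : F) := mobius_perm (translation_det u).

Lemma translationS u x : translation u (Some x) = Some (x + u).
Proof. by rewrite mobius_permE /= mul0r add0r oner_eq0 mul1r divr1. Qed.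

Lemma translation_oo u : translation u oo = oo.
Proof. by rewrite mobius_permE /= eqxx. Qed.

Lemma translation_PSL2 u : translation u \in G.
Proof. exact: mobius_perm_PSL2. Qed.

Lemma translation0 : translation 0 = 1%g.
Proof.
by apply/permP=> -[x|]; rewrite perm1 ?translation_oo // translationS addr0.
Qed.

Lemma translation_inj : injective translation.
Proof.
by move=> u v /permP/(_ (Some 0)); rewrite !translationS !add0r => -[].
Qed.

Lemma translationM u v : (translation u * translation v)%g = translation (u + v).
Proof.
by apply/permP=> -[x|]; rewrite permM ?translation_oo // !translationS addrA.
Qed.

Lemma PSL2_fix_oo g : g \in G -> g oo = oo ->
  exists2 a, a != 0 & exists b, forall x, g (Some x) = Some (a * x + b).
Proof.
case/PSL2P=> a [b [c [d [D eg]]]]; rewrite eg /=; case: eqVneq => // c0 _.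
move: D; rewrite c0 mulr0 subr0 mulf_eq0 => /norP[a0 d0].
exists (a / d); first by rewrite mulf_neq0 ?invr_eq0.
exists (b / d) => x; rewrite eg /= c0 mul0r add0r (negPf d0).
by congr Some; field.
Qed.

(** With [PSL2_3trans]: the action is sharply 3-transitive. *)
Lemma PSL2_eq g h : g \in G -> h \in G -> g oo = h oo ->
  g (Some 0) = h (Some 0) -> g (Some 1) = h (Some 1) -> g = h.
Proof.
move=> gG hG eo e0 e1; apply/eqP; rewrite eq_mulgV1; apply/eqP.
have ghG : (g * h^-1)%g \in G by rewrite groupM ?groupV.
have fixh x : g x = h x -> (g * h^-1)%g x = x by rewrite permM => ->; rewrite permK.
have [a a0 [b e]] := PSL2_fix_oo ghG (fixh _ eo).
move: (e 0) (e 1); rewrite !fixh // mulr0 add0r => -[b0] [a1].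
rewrite -b0 addr0 mulr1 in a1.
apply/permP=> -[x|]; rewrite perm1; last exact: fixh.
by rewrite e -b0 -a1 mul1r addr0.
Qed.

Lemma PSL2_to_oo p : exists2 g, g \in G & g p = oo.
Proof.
case: p => [p|]; last by exists 1%g; rewrite ?group1 ?perm1.
have D : 0 * (- p) - 1 * 1 != 0 :> F.
  by rewrite mul0r sub0r mulr1 oppr_eq0 oner_neq0.
exists (mobius_perm D); first exact: mobius_perm_PSL2.
by rewrite mobius_permE /= mul1r subrr eqxx.
Qed.

Lemma PSL2_3trans p0 p1 p2 : p0 != p1 -> p0 != p2 -> p1 != p2 ->
  exists2 g, g \in G & [/\ g oo = p0, g (Some 0) = p1 & g (Some 1) = p2].
Proof.
move=> n01 n02 n12; have [g gG gp] := PSL2_to_oo p0.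
have im p : p0 != p -> exists x, g p = Some x.
  rewrite -(inj_eq (@perm_inj _ g)) gp; case: (g p) => // x _; by exists x.
have [[x ex] [y ey]] := (im _ n01, im _ n02).
have xy : y - x != 0.
  by move: n12; rewrite -(inj_eq (@perm_inj _ g)) ex ey subr_eq0 eq_sym.
have D : (y - x) * 1 - x * 0 != 0 by rewrite mulr0 subr0 mulr1.
exists (mobius_perm D * g^-1)%g; first by rewrite groupM ?groupV ?mobius_perm_PSL2.
rewrite !permM !mobius_permE /= eqxx !mul0r add0r oner_eq0 !divr1 mulr0 mulr1.
rewrite add0r subrK.
by rewrite -gp -ex -ey !permK.
Qed.

Lemma mobius_scale (e a b c d : F) : e != 0 ->
  mobius (e * a) (e * b) (e * c) (e * d) =1 mobius a b c d.
Proof.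
move=> e0 [x|] /=.
  rewrite -mulrA -mulrDr mulf_eq0 (negPf e0) /=; case: eqVneq => // cd0.
  by congr Some; field; rewrite cd0 e0.
rewrite mulf_eq0 (negPf e0) /=; case: eqVneq => // c0.
by congr Some; field; rewrite c0.
Qed.

Lemma sqrt_pchar2 (x : F) : exists y : F, y ^+ 2 = x.
Proof.
have sq_inj : injective (fun y : F => y ^+ 2).
  move=> y z /eqP; rewrite -subr_eq0 subr_sqr mulf_eq0 subr_eq0 addr_eq0.
  by rewrite oppr_pchar2 // orbb => /eqP.
by have /codomP[y ->] := inj_card_onto sq_inj (leqnn _) x; exists y.
Qed.

Local Notation t := (translation 1).

Lemma translation1_neq1 : t != 1%g.
Proof. by rewrite -translation0 (inj_eq translation_inj) oner_neq0. Qed.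

Lemma translation1_order : #[t]%g = 2%N.
Proof.
apply: nt_prime_order; rewrite ?translation1_neq1 //.
by rewrite expgS expg1 translationM addrr_pchar2 ?translation0.
Qed.

Lemma translation1_fix p : (t p == p) = (p == oo).
Proof.
case: p => [x|]; last by rewrite translation_oo eqxx.
rewrite translationS; apply/eqP => -[] /eqP.
by rewrite -subr_eq0 addrAC subrr add0r oner_eq0.
Qed.

(** An element that commutes with t fixes the only fixed point of t, hence is
    affine; commuting with x + 1 it has slope 1. *)
Lemma cent_translation1 g :
  (g \in 'C_G[t])%g = (g \in [set translation u | u : F]).
Proof.
apply/setIP/imsetP => [[gG /cent1P cg]|[u _ ->]]; last first.
  split; first exact: translation_PSL2.
  by apply/cent1P; rewrite /commute !translationM addrC.
have go : g oo = oo.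
  by apply/eqP; rewrite -translation1_fix -permM cg permM translation_oo.
have [a a0 [b e]] := PSL2_fix_oo gG go; exists b => //.
have /permP/(_ (Some 0)) := cg.
rewrite !permM translationS !e translationS mulr0 !add0r mulr1 => -[ab].
have a1 : a = 1 by apply: (addIr b); rewrite -ab addrC.
by apply/permP=> -[x|]; rewrite ?go ?translation_oo // e translationS a1 mul1r.
Qed.

Lemma card_cent_translation1 : #|('C_G[t])%g| = #|F|.
Proof.
by rewrite (eq_card cent_translation1) card_imset //; apply: translation_inj.
Qed.

Lemma inverted_by_translation1 g :
  (g ^ t)%g = (g^-1)%g -> forall p, g (t (g p)) = t p.
Proof.
move=> gt p; have gtV : (g * t = t * g^-1)%g by rewrite -gt conjgE mulKVg.
by rewrite -[g (t (g p))]permM -permM mulgA gtV mulgKV.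
Qed.

(** An affine map of slope a can be conjugate to its inverse by a translation only
    if a^2 = 1, and then a = 1 in characteristic 2. *)
Lemma inverted_fix_oo g : g \in G -> (g ^ t)%g = (g^-1)%g -> g oo = oo ->
  exists u, g = translation u.
Proof.
move=> gG /inverted_by_translation1 gt go.
have [a a0 [b e]] := PSL2_fix_oo gG go; exists b.
have := gt (Some 0); rewrite !(e, translationS) => -[e0].
have := gt (Some 1); rewrite !(e, translationS) => -[e1].
have /eqP : (a + 1) ^+ 2 = 0.
  transitivity ((a * (a * 1 + b + 1) + b) + (a * (a * 0 + b + 1) + b) + 1).
    by ring2 F2.
  by rewrite e0 e1 add0r addrr_pchar2 // add0r addrr_pchar2.
rewrite expf_eq0 /= addr_eq0 oppr1_pchar2 // => /eqP a1.
by apply/permP=> -[x|]; rewrite ?go ?translation_oo // e translationS a1 mul1r.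
Qed.

(** That t inverts g means that g t is an involution, i.e. that its matrix has
    trace 0.  After scaling the lower left entry to 1, two parameters remain. *)
Lemma inverted_move_oo g : g \in G -> (g ^ t)%g = (g^-1)%g -> g oo != oo ->
  exists r d, r ^+ 2 + r + d != 0 /\ g =1 mobius (r + 1) d 1 r.
Proof.
move=> gG /inverted_by_translation1 gt; have [a [b [c [d [D eg]]]]] := PSL2P _ gG.
rewrite eg /=; have [_|c0 _] := eqVneq c 0; first by rewrite eqxx.
have goo : g oo = Some (a / c) by rewrite eg /= (negPf c0).
have := gt oo; rewrite goo translationS translation_oo eg /=.
case: eqP => // ecd _; have ea : a = c + d.
  apply/eqP; rewrite -subr_eq0 oppr_pchar2 //; apply/eqP; rewrite -[RHS]ecd.
  by field.
exists (d / c), (b / c); split; last first.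
  move=> x; rewrite eg -[RHS](mobius_scale _ _ _ _ c0).
  by congr mobius; rewrite ?ea; field.
have -> : (d / c) ^+ 2 + d / c + b / c = (a * d + b * c) / c ^+ 2.
  by rewrite ea; field.
by rewrite mulf_neq0 // ?invr_eq0 ?expf_neq0 // -[b * c]oppr_pchar2.
Qed.

(** The fixed points of g are the roots of x^2 + x + d, and commuting elements
    have the same fixed points.  So d is an invariant of an abelian group of
    elements inverted by t. *)
Lemma inverted_commute r d r' d' (g g' : {perm option F}) :
  r ^+ 2 + r + d != 0 -> g =1 mobius (r + 1) d 1 r ->
  g' =1 mobius (r' + 1) d' 1 r' -> commute g g' -> d = d'.
Proof.
move=> w0 eg eg' cgg'.
have com x : g' (g x) = g (g' x) by rewrite -!permM cgg'.
have := com oo; rewrite eg [in RHS]eg' /= oner_eq0 !divr1 eg' eg /= !mul1r.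
have -> : r' + 1 + r = r + 1 + r' by ring.
case: eqVneq => [rr' _|rr' [/(divIf rr')]]; last first.
  have -> : (r' + 1) * (r + 1) = (r + 1) * (r' + 1) by rewrite mulrC.
  by move/addrI.
have er : r = r' + 1.
  by apply/eqP; rewrite -subr_eq0 oppr_pchar2 // -rr'; apply/eqP; ring.
have := com (Some r'); rewrite eg [in RHS]eg' /= !mul1r addrr_pchar2 // eqxx.
rewrite [RHS]eg /= oner_eq0 divr1.
have -> : r' + r = 1 by rewrite er; ring2 F2.
rewrite oner_eq0 divr1 eg' /= mul1r.
have w0' : (r + 1) * r' + d + r' != 0.
  by apply: contraNN w0 => /eqP <-; apply/eqP; rewrite er; ring2 F2.
rewrite (negPf w0') => -[] /(canRL (mulfVK w0')).
rewrite er => e; apply/esym/eqP; rewrite -subr_eq0 oppr_pchar2 //.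
apply/eqP; transitivity ((r' + 1) * ((r' + 1 + 1) * r' + d) + d' +
  (r' + 1 + 1) * ((r' + 1 + 1) * r' + d + r')).
  by ring2 F2.
by rewrite e; ring2 F2.
Qed.

Lemma fibSS (w : F) m : fib w m.+2 = fib w m.+1 + w * fib w m. Proof. by []. Qed.

(** The matrix M of g has trace 1 and determinant w = r^2 + r + d, so the
    Cayley-Hamilton theorem gives M^(m + 1) = fib w (m + 1) M + w fib w m. *)
Lemma inverted_expg r d (g : {perm option F}) m :
  r ^+ 2 + r + d != 0 -> g =1 mobius (r + 1) d 1 r ->
  ((g ^+ m)%g oo == oo) = (fib (r ^+ 2 + r + d) m == 0).
Proof.
set w := _ + d => w0 eg; case: m => [|m]; first by rewrite expg0 perm1 !eqxx.
suff [_ ->] :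
    ((r + 1) * fib w m.+1 + w * fib w m) * (r * fib w m.+1 + w * fib w m) -
    (d * fib w m.+1) * fib w m.+1 = w ^+ m.+1 /\ (g ^+ m.+1)%g =1
  mobius ((r + 1) * fib w m.+1 + w * fib w m) (d * fib w m.+1)
         (fib w m.+1) (r * fib w m.+1 + w * fib w m).
  by rewrite /=; case: (fib w m.+1 =P 0) => //; case: eqP.
elim: m => [|m [D IH]].
  rewrite expg1 expr1 /= !mulr1 !mulr0 !addr0; split; last exact: eg.
  by rewrite oppr_pchar2 // /w; ring.
have D1 : (r + 1) * r - d * 1 = w by rewrite oppr_pchar2 // /w; ring.
split.
  rewrite exprS -D fibSS; move: (fib w m.+1) (fib w m) => A B.
  by rewrite /w; ring2 F2.
move=> x; rewrite expgSr permM IH eg mobius_comp ?D ?D1 ?expf_neq0 // fibSS.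
move: (fib w m.+1) (fib w m) => A B.
by rewrite /w; congr mobius; ring2 F2.
Qed.

Lemma inverted_fix r d (g : {perm option F}) p :
  r ^+ 2 + r + d != 0 -> g =1 mobius (r + 1) d 1 r ->
  (g p == p) = (if p is Some x then x ^+ 2 + x + d == 0 else false).
Proof.
move=> w0 eg; rewrite eg; case: p => [x|] /=; last by rewrite oner_eq0.
rewrite mul1r; case: ifPn => xr.
  apply/esym/negbTE; apply: contraNN w0 => /eqP <-.
  have -> : x = r by apply/eqP; rewrite -subr_eq0 oppr_pchar2.
  by [].
rewrite -[Some _ == _]/(_ / _ == x) -(inj_eq (mulIf xr)) divfK //.
rewrite -subr_eq0 oppr_pchar2 //; congr (_ == 0); ring2 F2.
Qed.

(** An involution has a fixed point, namely a square root of b / c if c is not 0.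
    Moving this point to oo makes the involution a translation, which a
    homothety turns into t. *)
Lemma PSL2_involution g : g \in G -> g != 1%g -> (g * g = 1)%g ->
  exists2 h, h \in G & (g ^ h)%g = t.
Proof.
suff tr g1 : g1 \in G -> g1 oo = oo -> g1 != 1%g -> (g1 * g1 = 1)%g ->
    exists2 h, h \in G & (g1 ^ h)%g = t.
  move=> gG g1 gg; suff [p gp]: exists p, g p = p.
    have [h hG hp] := PSL2_to_oo p.
    have [||||k kG ek] := tr (g ^ h)%g.
    - by rewrite groupJ.
    - by rewrite -hp conjgE !permM permK gp.
    - by rewrite conjg_eq1.
    - by rewrite -conjMg gg conj1g.
    by exists (h * k)%g; rewrite ?groupM // conjgM.
  have [a [b [c [d [D eg]]]]] := PSL2P _ gG.
  have [c0|c0] := eqVneq c 0; first by exists oo; rewrite eg /= c0 eqxx.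
  have goo : g oo = Some (a / c) by rewrite eg /= (negPf c0).
  have := congr1 (fun s : {perm option F} => s oo) gg.
  rewrite permM goo perm1 eg /=; case: eqP => // ad _.
  have {}ad : d = a.
    apply/eqP; rewrite -subr_eq0 oppr_pchar2 // -[X in _ == X]ad.
    by apply/eqP; field.
  have [x xx] := sqrt_pchar2 (b / c).
  have eb : b = c * x ^+ 2 by rewrite xx; field.
  have cxa : c * x + a != 0.
    apply: contraNneq D => cxa; rewrite ad eb oppr_pchar2 //.
    have -> : a * a + c * x ^+ 2 * c = (c * x + a) ^+ 2 by ring2 F2.
    by rewrite cxa expr0n.
  exists (Some x); rewrite eg /= ad (negPf cxa); congr Some.
  by rewrite eb; apply: (mulIf cxa); rewrite divfK //; ring.
move=> gG go gn1 gg; have [a a0 [b e]] := PSL2_fix_oo gG go.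
have g2 x : g1 (g1 x) = x by rewrite -permM gg perm1.
have := g2 (Some 0); rewrite !e => -[e0].
have := g2 (Some 1); rewrite !e => -[e1].
have /eqP : (a + 1) ^+ 2 = 0.
  transitivity ((a * (a * 1 + b) + b) + (a * (a * 0 + b) + b) + 1).
    by ring2 F2.
  by rewrite e0 e1 addr0 addrr_pchar2.
rewrite expf_eq0 /= addr_eq0 oppr1_pchar2 // => /eqP a1.
have b0 : b != 0.
  apply: contraNneq gn1 => b0; apply/eqP/permP=> -[x|]; rewrite perm1 // e.
  by rewrite a1 b0 mul1r addr0.
have D : 1 * b - 0 * 0 != 0 by rewrite mul1r mul0r subr0.
exists (mobius_perm D); first exact: mobius_perm_PSL2.
suff eh : (g1 * mobius_perm D = mobius_perm D * t)%g by rewrite conjgE eh mulKg.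
apply/permP=> -[x|]; rewrite !permM; last first.
  by rewrite go (mobius_permE D) /= eqxx translation_oo.
rewrite e !(mobius_permE D) /= !mul0r !add0r (negPf b0) translationS a1.
by congr Some; field.
Qed.

End Mobius.

(** * Orbits that are designs *)

Section Designs.

Variables (F : finFieldType).
Local Notation G := (PSL2 F).
Local Notation oo := (@None F).
Local Notation stab B := ('C_(PSL2 F)[B | 'P^*])%g.

Lemma stabP (B : {set option F}) g :
  reflect (g \in G /\ forall x, (g x \in B) = (x \in B)) (g \in stab B).
Proof.
apply: (iffP setIP) => -[gG gB]; split=> //.
  move/astab1P: gB => /= eB x; rewrite -{1}eB /= /setact /=.
  by rewrite (mem_imset _ _ (@perm_inj _ g)).
apply/astab1P; apply/setP=> y; apply/imsetP/idP => [[x xB ->]|yB].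
  by rewrite /= /aperm gB.
by exists (g^-1%g y); rewrite /= ?/aperm ?permKV // -gB permKV.
Qed.

Lemma card_PSL2_triples (B : {set option F}) :
  #|[set k in G | [&& k oo \in B, k (Some 0) \in B & k (Some 1) \in B]]| =
  #|B| ^_ 3.
Proof.
rewrite -card_uniq_tuples.
set S := [set k in G | _].
pose tr (k : {perm option F}) := [tuple k oo; k (Some 0); k (Some 1)].
have tr_inj : {in S &, injective tr}.
  move=> k l /setIdP[kG _] /setIdP[lG _].
  by move/(congr1 val) => /= -[e0 e1 e2]; apply: PSL2_eq.
rewrite -(card_in_imset tr_inj); apply: eq_card => s; rewrite [RHS]inE.
apply/imsetP/andP.
  case=> k /setIdP[kG /and3P[k0 k1 k2]] ->.
  split; first by apply/and4P; split.
  rewrite /= !inE !(inj_eq (@perm_inj _ k)) -[Some 0 == Some 1]/(0 == 1 :> F).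
  by rewrite [0 == 1]eq_sym oner_eq0.
case/tupleP: s => p0 s; case/tupleP: s => p1 s; case/tupleP: s => p2 s.
rewrite tuple0 /= !inE !andbT negb_or => -[/and3P[p0B p1B p2B]].
case/andP=> /andP[n01 n02] n12.
have [k kG [e0 e1 e2]] := PSL2_3trans n01 n02 n12.
exists k; last by apply: val_inj; rewrite /= e0 e1 e2.
by apply/setIdP; rewrite e0 e1 e2; split=> //; apply/and3P.
Qed.

(** Both sides count the g in G such that g(B) contains A.  On the left they are
    sorted by g(B).  On the right g is determined by the preimages of the three
    points of A, which form an arbitrary triple of distinct points of B. *)
Lemma design_count (A B : {set option F}) : #|A| = 3%N ->
  (#|stab B| * #|[set B' in orbit 'P^* G B | A \subset B']| = #|B| ^_ 3)%N.
Proof.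
move=> cA; rewrite -card_PSL2_triples.
have [p0 [p1 [p2 [n01 n02 n12 eA]]]] : exists p0 p1 p2,
    [/\ p0 != p1, p0 != p2, p1 != p2 & A =i [:: p0; p1; p2]].
  move: (mem_enum A) (enum_uniq A); rewrite cardE in cA.
  case: (enum A) cA => [|p0 [|p1 [|p2 []]]] //= _ eA.
  rewrite !inE negb_or !andbT => /andP[/andP[n01 n02] n12].
  by exists p0, p1, p2; split=> // x; rewrite -eA.
have [h hG [h0 h1 h2]] := PSL2_3trans n01 n02 n12.
pose S := [set g in G | A \subset 'P^*%act B g].
transitivity #|S|.
  apply/esym; rewrite -sum1_card.
  rewrite (partition_big ('P^*%act B)
    (mem [set B' in orbit 'P^* G B | A \subset B'])); last first.
    by move=> g /setIdP[gG Ag]; apply/setIdP; rewrite mem_orbit.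
  rewrite mulnC -sum_nat_const; apply: eq_bigr => B'.
  move=> /setIdP[/orbitP[g gG <-] Ag].
  rewrite sum1_card -(card_rcoset _ g) -amove_act ?subsetT //.
  apply: eq_card => k; rewrite [RHS]inE; apply/andP/andP => -[].
    by case/setIdP=> kG _ ek.
  by move=> kG ek; split=> //; apply/setIdP; rewrite (eqP ek).
pose f (g : {perm option F}) := (h * g^-1)%g.
have f_inj : injective f by move=> g g' /mulgI /invg_inj.
rewrite -(card_imset S f_inj).
apply: eq_card => k; apply/imsetP/idP.
  case=> g /setIdP[gG /subsetP Ag] ->.
  apply/setIdP; rewrite groupM ?groupV //= !permM h0 h1 h2.
  have mem p : p \in A -> g^-1%g p \in B.
    by move/Ag => /imsetP[x xB ->]; rewrite /= /aperm permK.
  by rewrite !mem // eA !inE eqxx ?orbT.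
case/setIdP=> kG /and3P[k0 k1 k2].
exists (k^-1 * h)%g; last by rewrite /f invMg invgK mulKVg.
apply/setIdP; split; first by rewrite groupM ?groupV.
apply/subsetP=> p.
have mem x : k x \in B -> h x \in 'P^*%act B (k^-1 * h)%g.
  by move=> kx; apply/imsetP; exists (k x); rewrite //= /aperm permM permK.
by rewrite eA !inE -h0 -h1 -h2 => /or3P[] /eqP->; apply: mem.
Qed.

Lemma orbit_is_design (B : {set option F}) : #|B| = 13%N ->
  is_design 3 #|F|.+1 13 858 (orbit 'P^* G B) = (#|stab B| == 2%N).
Proof.
move=> cB; rewrite /is_design card_option eqxx /=.
have -> : [forall B' in orbit 'P^* G B, #|B'| == 13%N].
  apply/forall_inP=> _ /orbitP[g gG <-].
  by rewrite /= /setact card_imset ?cB //; apply: perm_inj.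
have count (A : {set option F}) : #|A| = 3%N ->
    (#|stab B| * #|[set B' in orbit 'P^* G B | A \subset B']| = 2 * 858)%N.
  by move=> cA; rewrite (design_count B cA) cB.
apply/forallP/eqP => [des | stab2 A]; last first.
  apply/implyP => /eqP /count; rewrite stab2 => /eqP.
  by rewrite eqn_mul2l.
pose A := [set oo; Some 0; Some 1].
have cA : #|A| = 3%N.
  rewrite /A setUC cardsU1 cards2 !inE /= -[Some 1 == Some 0]/(1 == 0).
  by rewrite oner_eq0.
have := count A cA; have := des A; rewrite cA eqxx /= => /eqP ->.
by move/eqP; rewrite eqn_mul2r => /eqP.
Qed.

End Designs.

(** * Blocks whose stabilizer is generated by x + 1 *)

Section OrbitsToBlocks.

Variables (F : finFieldType) (F2 : 2 \in [pchar F]).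
Local Notation G := (PSL2 F).
Local Notation stab B := ('C_(PSL2 F)[B | 'P^*])%g.
Local Notation t := (translation (1 : F)).

Lemma stab_act (B : {set option F}) g : g \in G ->
  stab ('P^*%act B g) = (stab B :^ g)%g.
Proof. by move=> gG; rewrite astab1_act -{1}(conjGid gG) -conjIg. Qed.

Definition blocks13 :=
  [set B : {set option F} | #|B| == 13%N & stab B == <[t]>%g].

Lemma stab_order2 (B : {set option F}) : #|stab B| = 2%N ->
  exists2 g, g \in G & stab ('P^*%act B g) = <[t]>%g.
Proof.
move=> sB; have [s sS s1] : exists2 s, s \in stab B & s != 1%g.
  by apply/trivgPn; rewrite trivg_card1 sB.
have os : #[s]%g = 2%N.
  apply/eqP; rewrite eqn_leq order_gt1 s1 andbT -sB.
  by rewrite subset_leq_card // cycle_subG.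
have sG : s \in G by case/setIP: sS.
have ss : (s * s = 1)%g by rewrite -[(s * s)%g]/(s ^+ 2)%g -os expg_order.
have [g gG sg] := PSL2_involution F2 sG s1 ss.
exists g => //; rewrite stab_act // -sg cycleJ; congr (_ :^ _)%g.
by apply/eqP; rewrite eq_sym eqEcard cycle_subG sS sB -orderE os.
Qed.

(** Two members of [blocks13] in the same orbit differ by an element that
    normalizes <t>, that is, commutes with t.  They form an orbit of the group
    of translations, in which the stabilizer has order 2. *)
Lemma card_orbit_blocks13 (B : {set option F}) : B \in blocks13 ->
  (#|[set B' in blocks13 | orbit 'P^* G B' == orbit 'P^* G B]| * 2 = #|F|)%N.
Proof.
rewrite inE => /andP[/eqP cB /eqP sB].
transitivity (#|orbit 'P^* 'C_G[t] B| * 2)%N.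
  congr (_ * _)%N; apply: eq_card => B'; rewrite !inE; apply/idP/idP.
    case/andP=> /andP[_ /eqP sB'] /eqP eO.
    have /orbitP[g gG eB'] : B' \in orbit 'P^* G B by rewrite -eO orbit_refl.
    rewrite -eB' mem_orbit // inE gG; apply/cent1P.
    rewrite -eB' stab_act // sB -cycleJ in sB'.
    have : (t ^ g)%g \in <[t]>%g by rewrite -sB' cycle_id.
    rewrite mem_cycle2 ?translation1_order // conjg_eq1.
    rewrite (negPf (translation1_neq1 F)).
    by move/eqP=> e; rewrite /commute [RHS]conjgC e.
  case/orbitP=> g /setIP[gG /cent1P cg] <-.
  rewrite stab_act // sB -cycleJ.
  have -> : (t ^ g)%g = t by rewrite conjgE -cg mulKg.
  rewrite card_imset; last exact: perm_inj.
  by rewrite cB orbit_act // !eqxx.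
have ct : #|'C_('C_G[t])[B | 'P^*]%g| = 2%N.
  have -> : ('C_('C_G[t])[B | 'P^*] = <[t]>)%g.
    rewrite setIAC -/(stab B) -sB; apply/setIidPl; rewrite sB cycle_subG.
    exact/cent1P.
  by rewrite -orderE translation1_order.
by rewrite card_orbit -(card_cent_translation1 F) -ct mulnC Lagrange // subsetIl.
Qed.

(** Each orbit in question meets [blocks13], all involutions being conjugate. *)
Lemma design_orbits_blocks : (m_ F 858 * #|F| = 2 * #|blocks13|)%N.
Proof.
rewrite [RHS]mulnC /m_; set M := [set O in _ | _].
rewrite -[#|blocks13|]sum1_card.
rewrite (partition_big (orbit 'P^* G) (mem M)); last first.
  move=> B; rewrite !inE => /andP[/eqP cB /eqP sB].
  apply/andP; split; first by apply: imset_f; rewrite inE cB.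
  by rewrite orbit_is_design // sB -orderE translation1_order.
rewrite big_distrl -sum_nat_const; apply: eq_bigr => O.
case/setIdP=> /imsetP[B]; rewrite inE => /eqP cB ->.
rewrite orbit_is_design // => /eqP sB.
have [g gG sBg] := stab_order2 sB.
have Bg : ('P^*%act B g) \in blocks13.
  by rewrite inE sBg eqxx card_imset ?cB //; apply: perm_inj.
rewrite -(card_orbit_blocks13 Bg) sum1_card; congr (_ * _)%N.
rewrite orbit_act //.
by apply: eq_card => B'; rewrite [LHS]inE.
Qed.

End OrbitsToBlocks.

(** * The Artin-Schreier map and the blocks invariant under x + 1 *)

Lemma card_preim_fibers (T T' : finType) (f : T -> T') (A : {set T})
    (D : {set T'}) k :
  (forall y, y \in D -> #|[set x in A | f x == y]| = k) ->
  #|[set x in A | f x \in D]| = (#|D| * k)%N.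
Proof.
move=> fib; rewrite -sum1_card (partition_big f (mem D)) /=; last first.
  by move=> x; rewrite inE => /andP[].
rewrite -sum_nat_const; apply: eq_bigr => y yD; rewrite -(fib _ yD) -sum1_card.
apply: eq_bigl => x; rewrite !inE -andbA; congr (_ && _).
by case: eqP => [->|]; rewrite ?yD ?andbF.
Qed.

Section ArtinSchreier.

Variables (F : finFieldType) (F2 : 2 \in [pchar F]).

(** The Artin-Schreier map: it is additive, and its fibers are the orbits of t
    on F. *)
Definition phi (x : F) := x ^+ 2 + x.

Lemma phiD x y : phi (x + y) = phi x + phi y.
Proof. by rewrite /phi; ring2 F2. Qed.

Lemma eq_addr_pchar2 (x y : F) : (x == y) = (x + y == 0).
Proof. by rewrite -[in RHS](oppr_pchar2 F2 y) subr_eq0. Qed.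

Lemma phi_eq0 x : (phi x == 0) = (x == 0) || (x == 1).
Proof. by rewrite [x == 1]eq_addr_pchar2 /phi -{2}[x]mulr1 -mulrDr mulf_eq0. Qed.

Lemma phi_eq x y : (phi x == phi y) = (x == y) || (x == y + 1).
Proof.
rewrite [LHS]eq_addr_pchar2 -phiD phi_eq0 [x == y]eq_addr_pchar2; congr (_ || _).
by rewrite [RHS]eq_addr_pchar2 addrA -eq_addr_pchar2.
Qed.

Lemma phi1 : phi 1 = 0.
Proof. by apply/eqP; rewrite phi_eq0 eqxx orbT. Qed.

Definition imphi := [set phi x | x : F].

Lemma imphiP y : reflect (exists x, y = phi x) (y \in imphi).
Proof. by apply: (iffP imsetP) => [[x _ ->]|[x ->]]; exists x. Qed.

Lemma imphiD x y : x \in imphi -> y \in imphi -> x + y \in imphi.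
Proof.
by move=> /imphiP[a ->] /imphiP[b ->]; apply/imphiP; exists (a + b); rewrite phiD.
Qed.

Lemma phi_fiber y : y \in imphi -> #|[set x | phi x == y]| = 2%N.
Proof.
case/imphiP=> x ->.
have -> : [set z | phi z == phi x] = [set x; x + 1].
  by apply/setP=> z; rewrite !inE phi_eq.
by rewrite cards2 eq_addr_pchar2 addrA addrr_pchar2 // add0r oner_neq0.
Qed.

Lemma card_preim_phi (C : {set F}) : C \subset imphi ->
  #|[set x | phi x \in C]| = (#|C| * 2)%N.
Proof.
move=> sC; rewrite -(@card_preim_fibers _ _ phi setT) => [|y yC].
  by apply: eq_card => x; rewrite !inE.
rewrite -[RHS](phi_fiber (subsetP sC _ yC)).
by apply: eq_card => x; rewrite !inE.
Qed.

Lemma card_imphi : (#|imphi| * 2 = #|F|)%N.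
Proof.
rewrite -card_preim_phi // -cardsT; apply: eq_card => x.
by rewrite !inE; apply/imphiP; exists x.
Qed.

(** Translation of C by e, subtraction and addition being the same. *)
Definition shift (e : F) (C : {set F}) := [set x | x + e \in C].

Lemma shiftD e e' C : shift e (shift e' C) = shift (e + e') C.
Proof. by apply/setP=> x; rewrite !inE addrA. Qed.

Lemma shift0 C : shift 0 C = C.
Proof. by apply/setP=> x; rewrite !inE addr0. Qed.

Lemma shiftK e : involutive (shift e).
Proof. by move=> C; rewrite shiftD addrr_pchar2 // shift0. Qed.

Lemma card_shift e C : #|shift e C| = #|C|.
Proof.
rewrite -(card_imset (mem C) (addIr e)); apply: eq_card => x; rewrite inE.
apply/idP/imsetP=> [xC|[y yC ->]]; last by rewrite -addrA addrr_pchar2 // addr0.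
by exists (x + e); rewrite // -addrA addrr_pchar2 // addr0.
Qed.

(** Outside oo the block is a union of orbits of t, described by their images
    under phi. *)
Definition block (C : {set F}) : {set option F} :=
  [set p | if p is Some x then phi x \in C else true].

Lemma block_inj (C D : {set F}) :
  C \subset imphi -> D \subset imphi -> block C = block D -> C = D.
Proof.
move=> sC sD /setP e; apply/setP=> c.
have eq x : (phi x \in C) = (phi x \in D) by have := e (Some x); rewrite !inE.
apply/idP/idP=> cC.
  by have /imphiP[x ex] := subsetP sC _ cC; rewrite ex -eq -ex.
by have /imphiP[x ex] := subsetP sD _ cC; rewrite ex eq -ex.
Qed.

Lemma card_block (C : {set F}) : C \subset imphi -> #|block C| = (#|C| * 2).+1%N.
Proof.
move=> sC; rewrite (cardsD1 None (block C)) inE -card_preim_phi //; congr _.+1.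
rewrite -[RHS](card_imset _ (@Some_inj _)).
apply: eq_card => -[x|]; rewrite !inE /=.
  by rewrite mem_imset ?inE //; apply: Some_inj.
by apply/esym/negbTE/imsetP=> -[].
Qed.

Lemma translation_block u (C : {set F}) : C \subset imphi ->
  (translation u \in 'C_(PSL2 F)[block C | 'P^*])%g = (shift (phi u) C == C).
Proof.
move=> sC; apply/stabP/eqP=> [[_ uC]|uC]; last first.
  split=> [|[x|]]; [exact: translation_PSL2 | | by rewrite translation_oo].
  by rewrite translationS !inE phiD -{2}uC inE.
apply/setP=> c; rewrite inE.
have eq x : (phi x + phi u \in C) = (phi x \in C).
  by have := uC (Some x); rewrite translationS !inE phiD.
have [/imphiP[x ->] // | cQ] := boolP (c \in imphi).
rewrite [RHS](contraNF (subsetP sC c)) //; apply: contraNF cQ => /(subsetP sC) cu.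
suff -> : c = c + phi u + phi u by apply: imphiD => //; apply/imphiP; exists u.
by rewrite -addrA addrr_pchar2 // addr0.
Qed.

Local Notation t := (translation (1 : F)).

Lemma translation1_block (C : {set F}) :
  C \subset imphi -> t \in ('C_(PSL2 F)[block C | 'P^*])%g.
Proof. by move=> sC; rewrite translation_block // phi1 shift0. Qed.

(** Since t moves the points other than oo in pairs, an invariant set of odd size
    contains oo. *)
Lemma translation1_stable_block (B : {set option F}) : odd #|B| ->
  t \in ('C_(PSL2 F)[B | 'P^*])%g ->
  exists2 C : {set F}, C \subset imphi & B = block C.
Proof.
move=> oB /stabP[_ tB].
pose C : {set F} := [set phi x | x in [set x | Some x \in B]].
have sC : C \subset imphi.
  by apply/subsetP=> _ /imsetP[x _ ->]; apply/imphiP; exists x.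
have BC x : (Some x \in B) = (phi x \in C).
  apply/idP/imsetP=> [xB | [y]]; first by exists x; rewrite ?inE.
  rewrite inE => yB /eqP; rewrite phi_eq => /orP[] /eqP -> //.
  by rewrite -translationS tB.
exists C => //; apply/setP=> -[x|]; rewrite !inE //.
apply: contraTT oB => noB.
suff -> : #|B| = (#|C| * 2)%N by rewrite muln2 odd_double.
rewrite -card_preim_phi // -[RHS](card_imset _ (@Some_inj _)).
apply: eq_card => -[x|]; first by rewrite mem_imset ?inE //; apply: Some_inj.
by rewrite (negPf noB); apply/esym/negbTE/imsetP=> -[].
Qed.

End ArtinSchreier.

(** * Stabilizers of the invariant blocks *)

Section Classification.

Variables (F : finFieldType) (F2 : 2 \in [pchar F]).
Local Notation G := (PSL2 F).
Local Notation oo := (@None F).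
Local Notation t := (translation (1 : F)).
Local Notation stab B := ('C_(PSL2 F)[B | 'P^*])%g.

Section InvertedGroup.

Variable K : {group {perm option F}}.
Hypotheses (KG : K \subset G) (abK : abelian K).
Hypothesis (invK : forall k, k \in K -> (k ^ t = k^-1)%g).
Hypothesis (freeK : forall k, k \in K -> k oo = oo -> k = 1%g).

Variables (r d : F) (g : {perm option F}).
Hypotheses (gK : g \in K) (w0 : phi r + d != 0) (eg : g =1 mobius (r + 1) d 1 r).

Definition oo_orbit := [set k oo | k : {perm option F} in K].

Lemma card_oo_orbit : #|oo_orbit| = #|K|.
Proof.
apply: card_in_imset => k l kK lK e; apply/eqP; rewrite eq_mulgV1; apply/eqP.
by apply: freeK; rewrite ?groupM ?groupV // permM e permK.
Qed.

(** The elements of K commute with g, so they share its parameter d; the value of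
    fib vanishes because the order of k divides #|K|. *)
Lemma inverted_form k : k \in K -> k != 1%g ->
  exists s, [/\ phi s + d != 0, k =1 mobius (s + 1) d 1 s &
                fib (phi s + d) #|K| = 0].
Proof.
move=> kK k1; have koo : k oo != oo by apply: contraNneq k1 => /freeK->.
have kG := subsetP KG _ kK.
have [s [d' [w0' ek]]] := inverted_move_oo F2 kG (invK kK) koo.
have ed : d = d'.
  apply: (inverted_commute F2 w0 eg ek); exact: (centsP abK).
rewrite -{}ed in w0' ek; exists s; split=> //; apply/eqP.
by rewrite -(inverted_expg F2 _ w0' ek) expg_cardG // perm1.
Qed.

Lemma mem_oo_orbit x : Some x \in oo_orbit ->
  phi x + d != 0 /\ fib (phi x + d) #|K| = 0.
Proof.
case/imsetP=> k kK ex; have k1 : k != 1%g.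
  by apply: contra_eqN ex => /eqP->; rewrite perm1.
have [s [ws ek fs]] := inverted_form kK k1.
by move: ex; rewrite ek /= oner_eq0 divr1 => -[->]; rewrite phiD // phi1 // addr0.
Qed.

Lemma inverted_group_fix k p : k \in K -> k != 1%g ->
  (k p == p) = (if p is Some x then phi x == d else false).
Proof.
move=> kK k1; have [s [ws ek _]] := inverted_form kK k1.
by rewrite (inverted_fix F2 _ ws ek); case: p => // x; rewrite [RHS]eq_addr_pchar2.
Qed.

End InvertedGroup.

Definition fib_roots m := [set w : F | fib w m == 0].

Lemma card_roots_le (p : {poly F}) n (R : {set F}) :
  p != 0 -> (size p <= n.+1)%N ->
  (forall x, x \in R -> p.[x] = 0) -> (#|R| <= n)%N.
Proof.
move=> p0 sp Rp; rewrite -ltnS; apply: leq_trans sp; rewrite cardE.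
apply: max_poly_roots; rewrite ?enum_uniq //; apply/allP=> x.
by rewrite mem_enum => /Rp /eqP.
Qed.

Lemma card_fib_roots13 : (#|fib_roots 13| <= 6)%N.
Proof.
apply: (@card_roots_le (Poly [:: 1; 1; 1; 0; 0; 1; 1])); last first.
- move=> x; rewrite inE (fib13 F2) => /eqP fx.
  by rewrite horner_Poly /= -[RHS]fx; ring.
- exact: size_Poly.
by apply: contraTneq isT => /(congr1 (fun p : {poly F} => p`_0)) /eqP;
   rewrite coef_Poly coef0 /= oner_eq0.
Qed.

Lemma card_fib_roots11 : (#|fib_roots 11| <= 5)%N.
Proof.
apply: (@card_roots_le (Poly [:: 1; 1; 0; 1; 1; 1])); last first.
- move=> x; rewrite inE (fib11 F2) => /eqP fx.
  by rewrite horner_Poly /= -[RHS]fx; ring.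
- exact: size_Poly.
by apply: contraTneq isT => /(congr1 (fun p : {poly F} => p`_0)) /eqP;
   rewrite coef_Poly coef0 /= oner_eq0.
Qed.

(** The three ways in which the stabilizer of [block C] can exceed <t>: it has a
    second translation, an element of order 13, or an element of order 11. *)
Definition has_symmetry (C : {set F}) :=
  [|| [exists e in imphi F :\ 0, shift e C == C],
      [exists d, C == shift d (fib_roots 13)] |
      [exists d, C == shift d (0 |: fib_roots 11)]].

(** Let H be the stabilizer.  If t commutes with an element of H outside <t>, this
    is a translation and C is invariant under a shift.  Otherwise H has an
    abelian subgroup K of index 2, inverted by t.  The block splits into P, the
    K-orbit of oo, which consists of the fixed points of the involutions of H;
    ZZ, the common fixed points of K, of which there are 0 or 2; and S, the
    points with trivial stabilizer, whose number is a multiple of 2 #|K|.  As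
    #|P| = #|K|, the order of K divides 13 or 11, so S is empty. *)
Lemma stab_asymmetric (C : {set F}) : C \subset imphi F -> #|C| = 6%N ->
  ~~ has_symmetry C -> stab (block C) = <[t]>%g.
Proof.
move=> sC cC; apply: contraNeq => nH.
pose H := ('C_(PSL2 F)[block C | 'P^*])%G; rewrite -[stab _]/(gval H) in nH.
have tH : t \in H by apply: translation1_block.
have [centt | ncent] := eqVneq 'C_H[t]%g <[t]>%g; last first.
  have: ~~ ('C_H[t]%g \subset <[t]>%g).
    apply: contraNN ncent => sub; rewrite eqEsubset sub cycle_subG.
    by apply/setIP; split; last exact/cent1P.
  case/subsetPn=> h /setIP[hH ht]; rewrite mem_cycle2 ?translation1_order // => hnt.
  have /imsetP[u _ eh] : h \in [set translation u | u : F].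
    by rewrite -cent_translation1 //; apply/setIP; split=> //; case/setIP: hH.
  apply/or3P/Or31; apply/existsP; exists (phi u).
  rewrite !inE -translation_block //.
  rewrite -eh hH andbT; apply/andP; split; last by apply/imphiP; exists u.
  apply: contraNN hnt; rewrite phi_eq0 // => /orP[] /eqP u01.
    by rewrite eh u01 translation0 eqxx.
  by rewrite eh u01 eqxx orbT.
have [K [abK KHt cH invK HK]] :=
  self_centralizing_involution tH (translation1_order F2) centt.
have /andP[KH tK] : (K \subset H) && (t \notin K).
  by move: KHt; rewrite subsetD1.
have sHG : H \subset G by apply: subsetIl.
have KG := subset_trans KH sHG.
have ot := translation1_order F2.
have freeK k : k \in K -> k oo = oo -> k = 1%g.
  move=> kK koo; have kH := subsetP KH _ kK.
  have [u ek] := inverted_fix_oo F2 (subsetP KG _ kK) (invK _ kK) koo.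
  have: k \in 'C_H[t]%g.
    rewrite inE kH; apply/cent1P; rewrite ek /commute !translationM //.
    by rewrite addrC.
  rewrite centt mem_cycle2 // => /orP[] /eqP // kt.
  by move: kK; rewrite kt (negPf tK).
have [g gK g1] : exists2 g, g \in K & g != 1%g.
  apply/trivgPn; apply: contraNN nH => /eqP K1.
  rewrite eq_sym eqEcard cycle_subG tH cH K1 cards1 /=.
  by rewrite -orderE ot.
have [r [d [w0 eg]]] : exists r d, phi r + d != 0 /\ g =1 mobius (r + 1) d 1 r.
  apply: (inverted_move_oo F2 (subsetP KG _ gK) (invK _ gK)).
  by apply: contraNneq g1 => /freeK->.
have Pw := mem_oo_orbit KG abK invK freeK gK w0 eg.
have Kfix := inverted_group_fix KG abK invK freeK gK w0 eg.
set P := oo_orbit K in Pw.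
have cP : #|P| = #|K| by apply: card_oo_orbit.
have PB : P \subset block C.
  apply/subsetP=> _ /imsetP[k kK ->]; have /stabP[_ ->] := subsetP KH _ kK.
  by rewrite inE.
pose Z := [set x : F | phi x \in C :&: [set d]].
pose ZZ : {set option F} := [set Some x | x in Z].
have cZ : #|ZZ| = (#|C :&: [set d]| * 2)%N.
  rewrite card_imset; last exact: Some_inj.
  by rewrite card_preim_phi // (subset_trans _ sC) ?subsetIl.
pose S := [set p in block C | ('C_H[p | 'P] == 1)%g].
have S_free p : p \in block C -> (p \in S) = (p \notin P) && (p \notin ZZ).
  move=> pB; rewrite inE pB andTb -negb_or; apply/idP/idP => [/eqP Hp|].
    have free h : h \in H -> h p = p -> h = 1%g.
      move=> hH hp; apply/set1P; rewrite -[[set 1%g]]/(1%g : {set _}) -Hp inE hH.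
      exact/astab1P.
    apply/orP=> -[/imsetP[k kK ep]|/imsetP[x]].
      have kH := subsetP KH _ kK.
      have /eqP: (t ^ k)%g = 1%g.
        apply: free; first by rewrite groupJ.
        by rewrite conjgE !permM ep permK translation_oo.
      by rewrite conjg_eq1 (negPf (translation1_neq1 F)).
    rewrite !inE => /andP[_ xd] ep; move/eqP: (g1); apply; apply: free.
      exact: subsetP KH _ gK.
    by apply/eqP; rewrite Kfix // ep xd.
  apply: contraR => /trivgPn[h /setIP[hH /astab1P]]; rewrite /= /aperm => hp h1.
  have [hK|hK] := boolP (h \in K).
    have := Kfix _ p hK h1; rewrite hp eqxx; case: p pB {hp} => // x xB xd.
    apply/orP; right; apply/imsetP; exists x => //.
    by move: xB; rewrite !inE -xd andbT.
  (* h is conjugate to t by l, so its fixed point p is the image of oo under l *)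
  have [/imsetP[l lH eh] _] := HK _ hH hK; apply/orP; left.
  have lp : (l^-1)%g p = oo.
    apply/eqP; rewrite -translation1_fix -(inj_eq (@perm_inj _ l)) permKV.
    by rewrite -[X in _ == X]hp eh conjgE !permM.
  have pl : p = l oo by rewrite -lp permKV.
  have [lK|lK] := boolP (l \in K); first by apply/imsetP; exists l.
  have [_ tlK] := HK _ lH lK; apply/imsetP; exists (t * l)%g => //.
  by rewrite permM translation_oo.
have cB : (#|P| + #|ZZ| + #|S| = 13)%N.
  have ZB : ZZ \subset block C.
    by apply/subsetP=> _ /imsetP[x xZ ->]; move: xZ; rewrite !inE => /andP[].
  have PZ : P :&: ZZ = set0.
    apply/setP=> p; rewrite [RHS]inE; apply/negP=> /setIP[pP /imsetP[x xZ ep]].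
    move: pP xZ; rewrite ep => /Pw[xd _]; rewrite !inE => /andP[_].
    by rewrite (eq_addr_pchar2 F2) (negPf xd).
  have -> : S = block C :\: (P :|: ZZ).
    apply/setP=> p; rewrite [RHS]inE; have [pB|pB] := boolP (p \in block C).
      by rewrite S_free // -negb_or inE andbT.
    by rewrite andbF; apply: contraNF pB => /setIdP[].
  have := cardsID (P :|: ZZ) (block C); rewrite card_block // cC => <-.
  congr (_ + _)%N; rewrite (setIidPr _) ?subUset ?PB //.
  by rewrite cardsU PZ cards0 subn0.
have cS : (#|H| %| #|S|)%N.
  have HS : [acts H, on S | 'P].
    apply/actsP=> h hH p; rewrite inE [RHS]inE.
    have /stabP[_ hB] := hH; rewrite -[in X in X && _]/(h p) hB; congr (_ && _).
    by rewrite astab1_act -{1}(conjGid hH) -conjIg conjsg_eq1.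
  rewrite -(acts_sum_card_orbit HS); apply: dvdn_sum => O /imsetP[p pS ->].
  by rewrite card_orbit; move: pS; rewrite inE => /andP[_ /eqP ->]; rewrite indexg1.
have BPZ p : #|S| = 0%N -> p \in block C -> (p \in P) || (p \in ZZ).
  move=> S0 pB; have : p \notin S by rewrite (cards0_eq S0) inE.
  by rewrite S_free // -negb_or negbK.
have K1 : (1 < #|K|)%N by rewrite cardG_gt1; apply/trivgPn; exists g.
have CZ : (#|C :&: [set d]| <= 1)%N.
  by rewrite -(cards1 d) subset_leq_card // subsetIr.
case/dvdnP: cS => j; rewrite cH => cS.
have eqC (D : {set F}) :
    (#|D| <= 6)%N -> C \subset shift d D -> [exists e, C == shift e D].
  move=> cD sCD; apply/existsP; exists d.
  by rewrite eqEcard sCD card_shift // cC.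
have [C0|C1] : #|C :&: [set d]| = 0%N \/ #|C :&: [set d]| = 1%N.
- by case: #|_| CZ => [|[|]] //; [left|right].
- have cK : #|K| = 13%N.
    have /primeP[_ dvd13] : prime 13 by [].
    have /dvd13 : (#|K| %| 13)%N.
      by rewrite -cB cP cZ C0 cS addn0 mulnCA mulnA dvdn_addr ?dvdn_mull.
    by rewrite gtn_eqF //= => /eqP.
  have S0 : #|S| = 0%N by move: cB; rewrite cP cK cZ C0; case: #|S|.
  apply/or3P/Or32; apply: eqC card_fib_roots13 _; apply/subsetP=> c cCc.
  have /imphiP[x ex] := subsetP sC _ cCc.
  have := BPZ (Some x) S0; rewrite inE -ex cCc => /(_ isT) /orP[].
    by case/Pw=> _; rewrite cK -ex !inE => ->.
  rewrite (cards0_eq (_ : #|ZZ| = 0%N)) ?inE //.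
  by rewrite cZ C0.
have cK : #|K| = 11%N.
  have /primeP[_ dvd11] : prime 11 by [].
  have /dvd11 : (#|K| %| 11)%N.
    rewrite -[11%N]/(13 - 2)%N -cB cP cZ C1 cS mul1n addnAC addnK mulnCA mulnA.
    by rewrite dvdn_addr ?dvdn_mull.
  by rewrite gtn_eqF //= => /eqP.
have S0 : #|S| = 0%N by move: cB; rewrite cP cK cZ C1; case: #|S|.
apply/or3P/Or33; apply: eqC.
  by rewrite cardsU1 -[6%N]/(1 + 5)%N leq_add ?leq_b1 ?card_fib_roots11.
apply/subsetP=> c cCc.
have /imphiP[x ex] := subsetP sC _ cCc.
have := BPZ (Some x) S0; rewrite inE -ex cCc => /(_ isT) /orP[].
  by case/Pw=> _; rewrite cK -ex !inE => ->; rewrite eqxx orbT.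
case/imsetP=> y; rewrite !inE => /andP[_ yd] [xy].
by rewrite -eq_addr_pchar2 // ex xy yd.
Qed.

Section RootSet.

Variables (m : nat) (r d : F).
Hypotheses (pm : prime m) (w0 : phi r + d != 0).
Hypothesis fw : fib (phi r + d) m = 0.

(** A root of fib _ m yields an element g of order m inverted by t.  The set P is
    the orbit of oo under <[g]>, and g fixes the points above d. *)
Lemma dihedral_witness : exists2 g, g \in G & exists2 P : {set option F},
  #|P| = m & [/\ oo \in P, forall p, p \in P -> g p \in P, g oo != oo &
    (forall x, Some x \in P -> phi x + d != 0 /\ fib (phi x + d) m = 0) /\
    (forall x, phi x = d -> g (Some x) = Some x)].
Proof.
have D : (r + 1) * r - d * 1 != 0.
  by rewrite oppr_pchar2 // mulr1 mulrDl mul1r -expr2.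
pose g := mobius_perm D; have eg : g =1 mobius (r + 1) d 1 r by apply: mobius_permE.
have gG : g \in G by apply: mobius_perm_PSL2.
have goo : g oo != oo by rewrite eg /= oner_eq0.
have g1 : g != 1%g by apply: contraNneq goo => ->; rewrite perm1.
have gt : (g ^ t)%g = (g^-1)%g.
  suff gtg : (g * t * g = t)%g.
    by apply: (mulIg g); rewrite conjgE -mulgA gtg !mulVg.
  apply/permP=> p; rewrite !permM !eg !mobius_permE.
  have Dt := translation_det (1 : F).
  rewrite mobius_comp // mobius_comp //; last first.
    by apply: contraNneq w0 => e; rewrite -[X in _ == X]e /phi; apply/eqP; ring2 F2.
  rewrite -[RHS](mobius_scale _ _ _ _ w0).
  by congr mobius; rewrite /phi; ring2 F2.
have invK k : k \in <[g]>%g -> (k ^ t)%g = (k^-1)%g.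
  by case/cycleP=> i ->; rewrite conjXg gt expgVn.
have gKG : <[g]>%g \subset G by rewrite cycle_subG.
(* such a k is a translation and commutes with g, which moves oo *)
have free k : k \in <[g]>%g -> k oo = oo -> k = 1%g.
  move=> kK koo; have kG := subsetP gKG _ kK.
  have [u ek] := inverted_fix_oo F2 kG (invK _ kK) koo.
  have cgk : commute g k by apply: (centsP (cycle_abelian g)); rewrite ?cycle_id.
  have : k (g oo) = g oo by rewrite -permM cgk permM koo.
  rewrite ek; case: (g oo) goo => // x _; rewrite translationS => -[].
  by rewrite -[RHS]addr0 => /addrI ->; rewrite translation0.
have og : #[g]%g = m.
  apply: nt_prime_order => //; apply: free; first exact: mem_cycle.
  by apply/eqP; rewrite (inverted_expg F2 _ w0 eg); apply/eqP.
have abK := cycle_abelian g; have gK := cycle_id g.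
exists g => //; exists (oo_orbit <[g]>%g).
  by rewrite card_oo_orbit // -orderE.
split=> //; first by apply/imsetP; exists 1%g; rewrite ?group1 ?perm1.
  move=> _ /imsetP[k kK ->]; apply/imsetP; exists (k * g)%g; rewrite ?permM //.
  by rewrite groupM // cycle_id.
split=> x.
  rewrite -og orderE; exact: (mem_oo_orbit gKG abK invK free gK w0 eg).
move=> xd; apply/eqP.
by rewrite (inverted_group_fix gKG abK invK free gK w0 eg) // xd.
Qed.

End RootSet.

(** The element of order m given by [dihedral_witness] permutes oo and the
    points above C :\ d, which form its orbit of oo, and fixes the points
    above d. *)
Lemma stab_roots m r d (C : {set F}) : prime m -> phi r + d != 0 ->
  fib (phi r + d) m = 0 -> C \subset imphi F -> (#|C :\ d| * 2).+1%N = m ->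
  (forall c, c + d != 0 -> fib (c + d) m = 0 -> c \in C) ->
  stab (block C) != <[t]>%g.
Proof.
move=> pm w0 fw sC cC inC.
have [g gG [P cP [ooP gP goo [Pw gd]]]] := dihedral_witness pm w0 fw.
have eP : P = block (C :\ d).
  apply/eqP; rewrite eqEcard card_block ?(subset_trans (subsetDl _ _)) //.
  rewrite cC cP leqnn andbT; apply/subsetP=> -[x|] xP; rewrite !inE //.
  by have [wx fx] := Pw _ xP; rewrite (eq_addr_pchar2 F2) wx inC.
apply: contraNneq goo => sB; have: g \in stab (block C).
  apply/setIP; split=> //; apply/astab1P => /=.
  apply/eqP; rewrite eqEcard card_setact leqnn andbT.
  apply/subsetP=> _ /imsetP[p pC ->]; rewrite /= /aperm.
  have [pP|] := boolP (p \in P).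
    move: (gP _ pP); rewrite eP; case: (g p) => [x|]; rewrite !inE //.
    by case/andP.
  rewrite eP; case: p pC => [x|]; rewrite !inE // => xC; rewrite xC andbT negbK.
  by move=> /eqP /gd ->.
rewrite sB mem_cycle2 ?translation1_order // => /orP[] /eqP ->.
  by rewrite perm1.
by rewrite translation_oo.
Qed.

Lemma stab_symmetric (C : {set F}) : C \subset imphi F -> #|C| = 6%N ->
  has_symmetry C -> stab (block C) != <[t]>%g.
Proof.
move=> sC cC /or3P[/existsP[e] | /existsP[d /eqP eC] | /existsP[d /eqP eC]].
- case/andP=> /setD1P[e0 /imphiP[u eu]] eC.
  apply: contraTneq eC => sB; rewrite eu -translation_block // sB.
  rewrite mem_cycle2 ?translation1_order // -[1%g](translation0 F).
  rewrite !(inj_eq (@translation_inj F)).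
  by rewrite -phi_eq0 // -eu.
- have dC : d \notin C.
    by rewrite eC !inE addrr_pchar2 // (fib13 F2) !expr0n /= !add0r oner_neq0.
  have [c cCc] : exists c, c \in C by apply/set0Pn; rewrite -card_gt0 cC.
  have /imphiP[r er] := subsetP sC _ cCc.
  apply: (@stab_roots 13 r d) => //.
  + by rewrite -er -(eq_addr_pchar2 F2); apply: contraNneq dC => <-.
  + by apply/eqP; move: cCc; rewrite eC er !inE.
  + by move: (cardsD1 d C); rewrite (negPf dC) cC add0n => <-.
  by move=> c' _ fc; rewrite eC !inE fc.
have dC : d \in C by rewrite eC !inE addrr_pchar2 ?eqxx.
have cCd : #|C :\ d| = 5%N by move: cC; rewrite (cardsD1 d) dC => -[].
have [c /setD1P[cd cCc]] : exists c, c \in C :\ d.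
  by apply/set0Pn; rewrite -card_gt0 cCd.
have /imphiP[r er] := subsetP sC _ cCc.
have w0 : phi r + d != 0 by rewrite -er -(eq_addr_pchar2 F2).
apply: (@stab_roots 11 r d) => //; last 2 first.
- by rewrite cCd.
- by move=> c' _ fc; rewrite eC !inE fc eqxx orbT.
by apply/eqP; move: cCc; rewrite eC !inE er (negPf w0).
Qed.

Lemma blocks13_card :
  #|blocks13 F| = #|[set C : {set F} |
    [&& C \subset imphi F, #|C| == 6%N & ~~ has_symmetry C]]|.
Proof.
set A := [set C | _].
have inj : {in A &, injective (@block F)}.
  by move=> C D; rewrite !inE => /and3P[sC _ _] /and3P[sD _ _]; apply: block_inj.
rewrite -(card_in_imset inj); apply: eq_card => B; rewrite inE.
apply/andP/imsetP=> [[/eqP cB /eqP sB] | [C]]; last first.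
  rewrite inE => /and3P[sC /eqP cC nC] ->.
  by rewrite card_block // cC stab_asymmetric.
have [||C sC eB] := @translation1_stable_block F F2 B.
- by rewrite cB.
- by rewrite sB cycle_id.
have cC : #|C| = 6%N.
  move: cB; rewrite eB card_block // -[13%N]/(6 * 2).+1 => -[] /eqP.
  by rewrite eqn_mul2r => /eqP.
exists C => //; rewrite inE sC cC eqxx /=; apply/negP=> /(stab_symmetric sC cC).
by rewrite -eB sB eqxx.
Qed.

End Classification.

(** * Degrees of the roots of fib _ 13 and fib _ 11 over GF(2) *)

Section RootArithmetic.

Variables (L : fieldType) (L2 : 2 \in [pchar L]).

(** Repeated squaring modulo w^6 + w^5 + w^2 + w + 1; at each step the last factor
    is the quotient of the division with remainder. *)
Lemma fib13_pow64 (w : L) : fib w 13 = 0 -> w ^+ 64 = w.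
Proof.
rewrite fib13 // => D0.
have e8 : w ^+ 8 = w ^+ 5 + w ^+ 4 + w ^+ 2 + 1.
  transitivity (w ^+ 5 + w ^+ 4 + w ^+ 2 + 1 +
    (w ^+ 6 + w ^+ 5 + w ^+ 2 + w + 1) * (w ^+ 2 + w + 1)); first by ring2 L2.
  by rewrite D0 mul0r addr0.
have e16 : w ^+ 16 = w ^+ 5 + w ^+ 4 + w ^+ 3 + w ^+ 2 + w.
  rewrite -[16%N]/(8 * 2)%N exprM e8.
  transitivity (w ^+ 5 + w ^+ 4 + w ^+ 3 + w ^+ 2 + w +
    (w ^+ 6 + w ^+ 5 + w ^+ 2 + w + 1) * (w ^+ 4 + w ^+ 3 + 1)); first by ring2 L2.
  by rewrite D0 mul0r addr0.
have e32 : w ^+ 32 = w ^+ 4 + w ^+ 3 + w ^+ 2.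
  rewrite -[32%N]/(16 * 2)%N exprM e16.
  transitivity (w ^+ 4 + w ^+ 3 + w ^+ 2 +
    (w ^+ 6 + w ^+ 5 + w ^+ 2 + w + 1) * (w ^+ 4 + w ^+ 3)); first by ring2 L2.
  by rewrite D0 mul0r addr0.
rewrite -[64%N]/(32 * 2)%N exprM e32.
transitivity (w + (w ^+ 6 + w ^+ 5 + w ^+ 2 + w + 1) * (w ^+ 2 + w)).
  by ring2 L2.
by rewrite D0 mul0r addr0.
Qed.

Lemma fib13_pow4 (w : L) : fib w 13 = 0 -> w ^+ 4 != w.
Proof.
rewrite fib13 // => D0; apply/eqP=> e4; have /eqP := oner_neq0 L; apply.
(* a Bezout relation between the two polynomials *)
transitivity ((w ^+ 4 + w) * (w ^+ 5 + w ^+ 3 + 1) +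
  (w ^+ 6 + w ^+ 5 + w ^+ 2 + w + 1) * (w ^+ 3 + w ^+ 2 + 1)); first by ring2 L2.
by rewrite D0 e4 addrr_pchar2 // !mul0r addr0.
Qed.

Lemma fib13_pow8 (w : L) : fib w 13 = 0 -> w ^+ 8 != w.
Proof.
rewrite fib13 // => D0; apply/eqP=> e8; have /eqP := oner_neq0 L; apply.
(* a Bezout relation between the two polynomials *)
transitivity ((w ^+ 8 + w) * (w ^+ 3 + w ^+ 2 + 1) +
  (w ^+ 6 + w ^+ 5 + w ^+ 2 + w + 1) * (w ^+ 5 + w ^+ 2 + 1)); first by ring2 L2.
by rewrite D0 e8 addrr_pchar2 // !mul0r addr0.
Qed.

Lemma fib11_pow16 (w : L) : fib w 11 = 0 -> w ^+ 16 = w ^+ 4 + w ^+ 3.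
Proof.
rewrite fib11 // => D0; rewrite -[16%N]/(8 * 2)%N exprM.
have -> : w ^+ 8 = w ^+ 3 + w ^+ 2 + w + 1.
  transitivity (w ^+ 3 + w ^+ 2 + w + 1 +
    (w ^+ 5 + w ^+ 4 + w ^+ 3 + w + 1) * (w ^+ 3 + w ^+ 2 + 1)); first by ring2 L2.
  by rewrite D0 mul0r addr0.
transitivity (w ^+ 4 + w ^+ 3 +
  (w ^+ 5 + w ^+ 4 + w ^+ 3 + w + 1) * (w + 1)); first by ring2 L2.
by rewrite D0 mul0r addr0.
Qed.

Lemma fib11_pow32 (w : L) : fib w 11 = 0 -> w ^+ 32 = w.
Proof.
move=> fw; rewrite -[32%N]/(16 * 2)%N exprM fib11_pow16 //.
rewrite fib11 // in fw.
transitivity (w + (w ^+ 5 + w ^+ 4 + w ^+ 3 + w + 1) * (w ^+ 3 + w ^+ 2 + w)).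
  by ring2 L2.
by rewrite fw mul0r addr0.
Qed.

Lemma fib11_pow4 (w : L) : fib w 11 = 0 -> w ^+ 4 != w.
Proof.
rewrite fib11 // => D0; apply/eqP=> e4; have /eqP := oner_neq0 L; apply.
(* a Bezout relation between the two polynomials *)
transitivity ((w ^+ 4 + w) * (w ^+ 4 + w ^+ 3 + w) +
  (w ^+ 5 + w ^+ 4 + w ^+ 3 + w + 1) * (w ^+ 3 + w + 1)); first by ring2 L2.
by rewrite D0 e4 addrr_pchar2 // !mul0r addr0.
Qed.

(** With w = y^2 + y, the difference y^32 - y telescopes to the trace
    w + w^2 + w^4 + w^8 + w^16, which is 1 because fib w 11 = 0.  So y is not in
    GF(32), although w is. *)
Lemma fib11_artin_schreier (y : L) : fib (y ^+ 2 + y) 11 = 0 -> y ^+ 32 = y + 1.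
Proof.
set w := y ^+ 2 + y => fw; have e16 := fib11_pow16 fw.
have sq (a b : L) : (a + b) ^+ 2 = a ^+ 2 + b ^+ 2 by ring2 L2.
have e2 : y ^+ 2 = y + w by rewrite /w; ring2 L2.
clearbody w.
have e4 : y ^+ 4 = y + w + w ^+ 2.
  by rewrite -[4%N]/(2 * 2)%N exprM e2 sq e2.
have e8 : y ^+ 8 = y + w + w ^+ 2 + w ^+ 4.
  by rewrite -[8%N]/(4 * 2)%N exprM e4 !sq e2 -exprM.
have e16y : y ^+ 16 = y + w + w ^+ 2 + w ^+ 4 + w ^+ 8.
  by rewrite -[16%N]/(8 * 2)%N exprM e8 !sq e2 -!exprM.
rewrite -[32%N]/(16 * 2)%N exprM e16y !sq e2 -!exprM e16.
rewrite fib11 // in fw.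
transitivity (y + 1 + (w ^+ 5 + w ^+ 4 + w ^+ 3 + w + 1) * (w ^+ 3 + w ^+ 2 + 1)).
  by ring2 L2.
by rewrite fw mul0r addr0.
Qed.

Lemma exprD_pow2 (x y : L) n : (x + y) ^+ (2 ^ n) = x ^+ (2 ^ n) + y ^+ (2 ^ n).
Proof. by rewrite exprDn_pchar // pnatX pnatE ?L2. Qed.

Lemma pow2_iter (x : L) a k : x ^+ (2 ^ a) = x -> x ^+ (2 ^ (a * k)) = x.
Proof.
move=> e; elim: k => [|k IH]; first by rewrite muln0 expn0 expr1.
by rewrite mulnS expnD exprM e.
Qed.

Lemma pow2_modn (x : L) a n :
  x ^+ (2 ^ a) = x -> x ^+ (2 ^ n) = x ^+ (2 ^ (n %% a)).
Proof.
by move=> e; rewrite {1}(divn_eq n a) mulnC expnD exprM pow2_iter.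
Qed.

(** Such a w lies in GF(64), but neither in GF(4) nor in GF(8). *)
Lemma fib13_period (w : L) n : fib w 13 = 0 -> w ^+ (2 ^ n) = w -> (6 %| n)%N.
Proof.
move=> fw; have w64 : w ^+ (2 ^ 6) = w by apply: fib13_pow64.
rewrite (pow2_modn _ w64) /dvdn; have := ltn_pmod n (isT : 0 < 6)%N.
have n4 := negP (fib13_pow4 fw); have n8 := negP (fib13_pow8 fw).
case: (n %% 6)%N => [|[|[|[|[|[|//]]]]]] // _ e.
- by case: n4; rewrite -[4%N]/((2 ^ 1) * (2 ^ 1))%N exprM !e.
- by case: n4; rewrite -[4%N]/(2 ^ 2)%N e.
- by case: n8; rewrite -[8%N]/(2 ^ 3)%N e.
- by case: n4; rewrite -{2}w64 -[(2 ^ 6)%N]/((2 ^ 4) * 4)%N exprM e.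
case: n4; have w2 : w ^+ 2 = w.
  by rewrite -{2}w64 -[(2 ^ 6)%N]/((2 ^ 5) * 2)%N exprM e.
by rewrite -[4%N]/(2 * 2)%N exprM !w2.
Qed.

(** Such a w lies in GF(32), but not in GF(2). *)
Lemma fib11_period (w : L) n : fib w 11 = 0 -> w ^+ (2 ^ n) = w -> (5 %| n)%N.
Proof.
move=> fw; have w32 : w ^+ (2 ^ 5) = w by apply: fib11_pow32.
rewrite (pow2_modn _ w32) /dvdn; have := ltn_pmod n (isT : 0 < 5)%N.
have n4 := negP (fib11_pow4 fw).
case: (n %% 5)%N => [|[|[|[|[|//]]]]] // _ e.
- by case: n4; rewrite -[4%N]/((2 ^ 1) * (2 ^ 1))%N exprM !e.
- by case: n4; rewrite -[4%N]/(2 ^ 2)%N e.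
- by case: n4; rewrite -{2}w32 -[(2 ^ 5)%N]/((2 ^ 3) * 4)%N exprM e.
case: n4; have w2 : w ^+ 2 = w.
  by rewrite -{2}w32 -[(2 ^ 5)%N]/((2 ^ 4) * 2)%N exprM e.
by rewrite -[4%N]/(2 * 2)%N exprM !w2.
Qed.

(** Here 5 divides n because y^2 + y has degree 5; the map y |-> y^32 adds 1 to y,
    so it has to be applied an even number of times to fix y. *)
Lemma fib11_artin_schreier_period (y : L) n :
  fib (y ^+ 2 + y) 11 = 0 -> y ^+ (2 ^ n) = y -> (10 %| n)%N.
Proof.
move=> fy yn; have y32 : y ^+ (2 ^ 5) = y + 1 by apply: fib11_artin_schreier.
have /fib11_period : fib (y ^+ 2 + y) 11 = 0 by [].
move=> /(_ n); rewrite exprD_pow2 -exprM mulnC exprM yn.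
move=> /(_ erefl) /dvdnP[k ek].
have y1024 : y ^+ (2 ^ 10) = y.
  rewrite -[10%N]/(5 + 5)%N expnD exprM y32 exprD_pow2.
  by rewrite y32 expr1n -addrA addrr_pchar2 // addr0.
have [ok|] := boolP (odd k); last first.
  by rewrite ek -dvdn2 => /dvdnP[l ->]; rewrite -mulnA dvdn_mull.
case/eqP: (oner_neq0 L); apply: (@addrI _ y); rewrite addr0 -{2}yn ek.
rewrite -(odd_double_half k) ok mulnDl mul1n -mul2n mulnAC expnD mulnC exprM.
by rewrite pow2_iter.
Qed.

End RootArithmetic.

(** * The root sets in a finite field *)

Section RootSets.

Variables (F : finFieldType) (F2 : 2 \in [pchar F]).
Variables (n : nat) (cardF : #|F| = (2 ^ n)%N).

(** Over K the polynomial X^#|F| - X is the product of the X - f x. *)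
Lemma fixed_by_card_in_image (K : fieldType) (f : {rmorphism F -> K}) (z : K) :
  z ^+ #|F| = z -> exists x, z = f x.
Proof.
move=> zq; have : root (map_poly f ('X^#|F| - 'X)) z.
  by rewrite rmorphB /= map_polyXn map_polyX rootE !hornerE zq subrr.
rewrite finField_genPoly rmorph_prod rootE horner_prod => /prodf_eq0[x _].
rewrite rmorphB /= map_polyX map_polyC !hornerE subr_eq0 => /eqP ->.
by exists x.
Qed.

Lemma expr_pow2_inj i : injective (fun x : F => x ^+ (2 ^ i)).
Proof.
move=> x y /eqP; rewrite (eq_addr_pchar2 F2) -exprD_pow2 // expf_eq0 expn_gt0 /=.
by rewrite -(eq_addr_pchar2 F2) => /eqP.
Qed.

Lemma card_conjugates (w : F) p : (forall s, w ^+ (2 ^ s) = w -> (p %| s)%N) ->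
  #|[set w ^+ (2 ^ i) | i : 'I_p]| = p.
Proof.
move=> per; rewrite card_imset ?card_ord // => i j.
wlog le_ij : i j / (i <= j)%N.
  by move=> W e; case: (leqP i j) => [/W|/ltnW /W]; [|move/(_ (esym e))]; auto.
move=> e; apply/val_inj/eqP; rewrite eqn_leq le_ij /= -subn_eq0.
have : w ^+ (2 ^ (j - i)) = w.
  by apply: (@expr_pow2_inj i); rewrite /= -exprM -expnD subnK.
move/per; apply: contraLR; rewrite -lt0n => ji; rewrite gtnNdvd //.
by rewrite (leq_ltn_trans (leq_subr _ _)).
Qed.

Lemma fib_frob m (w : F) i : fib w m = 0 -> fib (w ^+ (2 ^ i)) m = 0.
Proof.
move=> fw; suff [<- _] : fib w m ^+ (2 ^ i) = fib (w ^+ (2 ^ i)) m /\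
   fib w m.+1 ^+ (2 ^ i) = fib (w ^+ (2 ^ i)) m.+1.
  by rewrite fw expr0n expn_eq0.
elim: m {fw} => [|m [IH1 IH2]]; first by rewrite /= expr1n expr0n expn_eq0.
by split=> //; rewrite !fibSS exprD_pow2 // exprMn IH1 IH2.
Qed.

Lemma fib_roots13_dvd w : w \in fib_roots F 13 -> (6 %| n)%N.
Proof.
by rewrite inE => /eqP fw; apply: (fib13_period F2 fw); rewrite -cardF expf_card.
Qed.

Lemma phi_pow2 (y : F) i : phi (y ^+ (2 ^ i)) = phi y ^+ (2 ^ i).
Proof. by rewrite /phi exprD_pow2 // -!exprM mulnC. Qed.

Lemma conjugate_coset (w : F) i : w ^+ (2 ^ i) + w \in imphi F.
Proof.
elim: i => [|i IH].
  rewrite expr1 addrr_pchar2 //; apply/imphiP; exists 0.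
  by rewrite /phi expr0n addr0.
suff -> : w ^+ (2 ^ i.+1) + w = phi (w ^+ (2 ^ i)) + (w ^+ (2 ^ i) + w).
  by apply: imphiD => //; apply/imphiP; exists (w ^+ (2 ^ i)).
rewrite /phi -exprM -expnSr; move: (w ^+ _) (w ^+ (2 ^ i)) => a b.
by ring2 F2.
Qed.

Lemma fib_root_closed (K : closedFieldType) (K2 : 2 \in [pchar K]) :
  (exists w : K, fib w 13 = 0) /\ (exists w : K, fib w 11 = 0).
Proof.
split.
  have /closed_rootP[w] : size (Poly [:: 1; 1; 1; 0; 0; 1; 1 : K]) != 1%N.
    by rewrite (@PolyK _ 0) //= oner_neq0.
  move=> rw; exists w; rewrite fib13 //; move: rw.
  rewrite /root horner_Poly /= => /eqP rw; rewrite -[RHS]rw; ring.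
have /closed_rootP[w] : size (Poly [:: 1; 1; 0; 1; 1; 1 : K]) != 1%N.
  by rewrite (@PolyK _ 0) //= oner_neq0.
move=> rw; exists w; rewrite fib11 //; move: rw.
rewrite /root horner_Poly /= => /eqP rw; rewrite -[RHS]rw; ring.
Qed.

Lemma fib_rmorph (K : fieldType) (f : {rmorphism F -> K}) w m :
  f (fib w m) = fib (f w) m.
Proof.
suff [] : f (fib w m) = fib (f w) m /\ f (fib w m.+1) = fib (f w) m.+1 by [].
elim: m => [|m [IH1 IH2]]; first by rewrite /= rmorph0 rmorph1.
by split=> //; rewrite !fibSS rmorphD rmorphM IH1 IH2.
Qed.

(** A root in the algebraic closure is fixed by the 64th power map, hence lies in
    F if 6 divides n.  Its six conjugates are all the roots, and successive
    conjugates differ by a value of phi. *)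
Lemma fib_roots13_full : (6 %| n)%N -> exists2 w, #|fib_roots F 13| = 6%N &
  forall x, x \in fib_roots F 13 -> x + w \in imphi F.
Proof.
case/dvdnP=> k ek.
have [K [f _]] := countable_algebraic_closure F.
have K2 : 2 \in [pchar K] by apply: (rmorph_pchar f).
have [[z fz] _] := fib_root_closed K2.
have [w ew] : exists w, z = f w.
  apply: fixed_by_card_in_image; rewrite cardF ek mulnC pow2_iter //.
  exact: fib13_pow64.
have fw : fib w 13 = 0.
  by apply: (fmorph_inj f); rewrite rmorph0 fib_rmorph -ew.
have cR := card_conjugates (fun s => fib13_period F2 fw (n := s)).
have eR : [set w ^+ (2 ^ i) | i : 'I_6] = fib_roots F 13.
  apply/eqP; rewrite eqEcard cR card_fib_roots13 // andbT.
  by apply/subsetP=> _ /imsetP[i _ ->]; rewrite inE fib_frob.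
exists w => [|x]; first by rewrite -eR.
by rewrite -eR => /imsetP[i _ ->]; apply: conjugate_coset.
Qed.

(** Descending a solution y of y^2 + y = z, and not only the root z itself, shows
    that z is in the image of phi; so are its conjugates. *)
Lemma fib_roots11_full : (10 %| n)%N ->
  #|0 |: fib_roots F 11| = 6%N /\ 0 |: fib_roots F 11 \subset imphi F.
Proof.
case/dvdnP=> k ek.
have [K [f _]] := countable_algebraic_closure F.
have K2 : 2 \in [pchar K] by apply: (rmorph_pchar f).
have [_ [z fz]] := fib_root_closed K2.
have [y ey] : exists y : K, y ^+ 2 + y = z.
  have /closed_rootP[y] : size (Poly [:: - z; 1; 1]) != 1%N.
    by rewrite (@PolyK _ 0) //= oner_neq0.
  rewrite /root horner_Poly /= => /eqP ry; exists y.
  by apply/eqP; rewrite -subr_eq0 -[X in _ == X]ry; apply/eqP; ring.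
have fy : fib (y ^+ 2 + y) 11 = 0 by rewrite ey.
have [v ev] : exists v, y = f v.
  apply: fixed_by_card_in_image; rewrite cardF ek mulnC pow2_iter //.
  have y32 := fib11_artin_schreier K2 fy.
  rewrite -[10%N]/(5 + 5)%N expnD exprM -[(2 ^ 5)%N]/32%N y32.
  by rewrite -[32%N]/(2 ^ 5)%N exprD_pow2 // y32 expr1n -addrA addrr_pchar2 ?addr0.
pose w := phi v.
have fw : fib w 11 = 0.
  by apply: (fmorph_inj f); rewrite rmorph0 fib_rmorph /w /phi rmorphD rmorphXn -ev.
have cR := card_conjugates (fun s => fib11_period F2 fw (n := s)).
have eR : [set w ^+ (2 ^ i) | i : 'I_5] = fib_roots F 11.
  apply/eqP; rewrite eqEcard cR card_fib_roots11 // andbT.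
  by apply/subsetP=> _ /imsetP[i _ ->]; rewrite inE fib_frob.
split.
  have n0 : 0 \notin fib_roots F 11.
    by rewrite inE fib11 // !expr0n /= !add0r oner_neq0.
  by rewrite cardsU1 n0 -eR cR.
apply/subsetP=> x; rewrite !inE => /orP[/eqP ->|].
  by apply/imphiP; exists 0; rewrite /phi expr0n addr0.
move=> fx; have : x \in fib_roots F 11 by rewrite inE.
rewrite -eR => /imsetP[i _ ->]; apply/imphiP; exists (v ^+ (2 ^ i)).
by rewrite phi_pow2.
Qed.

Lemma fib_roots11_dvd w : w \in fib_roots F 11 -> w \in imphi F -> (10 %| n)%N.
Proof.
rewrite inE => /eqP fw /imphiP[y ey]; rewrite ey in fw.
by apply: (fib11_artin_schreier_period F2 fw); rewrite -cardF expf_card.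
Qed.

End RootSets.

(** * Counting the base sets of symmetric blocks *)

Section Counting.

Variables (F : finFieldType) (F2 : 2 \in [pchar F]).
Local Notation Q := (imphi F).

Definition sixsets := [set C : {set F} | C \subset Q & #|C| == 6%N].

Lemma card_sixsets : #|sixsets| = 'C(#|Q|, 6).
Proof. exact: cards_draws. Qed.

Section TranslationInvariant.

Variable e : F.
Hypothesis e0 : e != 0.

(** For the subgroup {0, e} what phi is for {0, 1}. *)
Definition psi (c : F) := c * (c + e).

Lemma psi_eq c c' : (psi c == psi c') = (c == c') || (c == c' + e).
Proof.
rewrite [LHS](eq_addr_pchar2 F2) [c == c'](eq_addr_pchar2 F2).
rewrite [c == c' + e](eq_addr_pchar2 F2).
by rewrite -mulf_eq0; congr (_ == 0); rewrite /psi; ring2 F2.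
Qed.

Lemma mem_shift_invariant (A : {set F}) c :
  shift e A = A -> (c + e \in A) = (c \in A).
Proof. by move=> eA; rewrite -{2}eA inE. Qed.

Lemma psi_fiber (A : {set F}) c : shift e A = A -> c \in A ->
  [set x in A | psi x == psi c] = [set c; c + e].
Proof.
move=> eA cA; apply/setP=> x; rewrite !inE psi_eq.
by apply/andb_idl => /orP[] /eqP -> //; rewrite mem_shift_invariant.
Qed.

Lemma notin_psi_fiber c : c \notin [set c + e].
Proof. by rewrite inE (eq_addr_pchar2 F2) addrA addrr_pchar2 // add0r. Qed.

Lemma card_psi_fiber (A : {set F}) y : shift e A = A -> y \in psi @: A ->
  #|[set x in A | psi x == y]| = 2%N.
Proof.
by move=> eA /imsetP[c cA ->]; rewrite psi_fiber // cardsU1 notin_psi_fiber cards1.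
Qed.

Lemma psi_preim (A C : {set F}) : C \subset A -> shift e C = C ->
  [set x in A | psi x \in psi @: C] = C.
Proof.
move=> sCA eC; apply/setP=> x; rewrite inE; apply/andP/idP=> [[_]|xC].
  case/imsetP=> c cC /eqP; rewrite psi_eq => /orP[] /eqP -> //.
  by rewrite mem_shift_invariant.
by split; [apply: (subsetP sCA) | apply: imset_f].
Qed.

Lemma card_psi (A : {set F}) : shift e A = A -> (#|psi @: A| * 2 = #|A|)%N.
Proof.
move=> eA; rewrite -{2}(psi_preim (subxx A) eA); apply/esym.
by apply: card_preim_fibers => y; apply: card_psi_fiber.
Qed.

(** The invariant sets are the unions of fibers of psi. *)
Lemma card_shift_invariant (A : {set F}) k : shift e A = A ->
  #|[set C : {set F} | [&& C \subset A, #|C| == (k * 2)%N & shift e C == C]]| =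
  'C(#|psi @: A|, k).
Proof.
move=> eA; rewrite -cards_draws.
set S := [set C | _]; rewrite -(card_in_imset (f := fun C : {set F} => psi @: C)).
  apply: eq_card => D; rewrite [RHS]inE; apply/imsetP/andP.
    case=> C; rewrite inE => /and3P[sC /eqP cC /eqP eC] ->.
    rewrite imsetS //; split=> //.
    by rewrite -(eqn_pmul2r (isT : 0 < 2)%N) card_psi ?cC.
  case=> sD /eqP cD; pose C := [set x in A | psi x \in D].
  have eC : shift e C = C.
    apply/setP=> x; rewrite !inE mem_shift_invariant //; congr (_ && (_ \in D)).
    by apply/eqP; rewrite psi_eq eqxx orbT.
  have sC : C \subset A by apply/subsetP=> x; rewrite inE => /andP[].
  have eD : psi @: C = D.
    apply/setP=> y; apply/imsetP/idP=> [[x] | yD].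
      by rewrite inE => /andP[_ xD] ->.
    have /imsetP[x xA ey] := subsetP sD _ yD.
    by exists x => //; rewrite inE xA -ey.
  by exists C => //; rewrite inE sC eC eqxx andbT -(card_psi eC) eD cD /=.
move=> C D; rewrite !inE => /and3P[sC _ /eqP eC] /and3P[sD _ /eqP eD] eCD.
by rewrite -(psi_preim sC eC) eCD psi_preim.
Qed.

(** The set consists of three pairs {c, c + e}, each of sum e.  In particular it
    is invariant under only one nonzero shift. *)
Lemma sum_shift_invariant (C : {set F}) : shift e C = C -> #|C| = 6%N ->
  \sum_(c in C) c = e.
Proof.
move=> eC cC; rewrite (partition_big_imset psi) /=.
transitivity (\sum_(y in psi @: C) e).
  apply: eq_bigr => _ /imsetP[c cC' ->].
  transitivity (\sum_(x in [set c; c + e]) x).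
    by apply: eq_bigl => x; rewrite -(psi_fiber eC cC') inE.
  by rewrite big_setU1 ?notin_psi_fiber //= big_set1 addrA addrr_pchar2 // add0r.
have c3 : #|psi @: C| = 3%N.
  by apply/eqP; rewrite -(eqn_pmul2r (isT : 0 < 2)%N) card_psi // cC.
by rewrite sumr_const c3 mulrS mulr2n addrr_pchar2 // addr0.
Qed.

End TranslationInvariant.

Lemma shift_imphi e : e \in Q -> shift e Q = Q.
Proof.
move=> eQ; apply/setP=> x; rewrite inE; apply/idP/idP => xQ; last exact: imphiD.
suff -> : x = x + e + e by apply: imphiD.
by rewrite -addrA addrr_pchar2 // addr0.
Qed.

Definition invariant_sixsets :=
  [set C in sixsets | [exists e in Q :\ 0, shift e C == C]].

(** By [sum_shift_invariant] the sets can be sorted by their sum. *)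
Lemma card_invariant_sixsets n : #|Q| = (2 ^ n)%N ->
  #|invariant_sixsets| = ((2 ^ n).-1 * 'C(2 ^ n.-1, 3))%N.
Proof.
move=> cQ; rewrite -sum1_card.
rewrite (partition_big (fun C : {set F} => \sum_(c in C) c)
  (mem (Q :\ 0))) /=; last first.
  move=> C /setIdP[]; rewrite inE => /andP[_ /eqP cC].
  case/existsP=> e /andP[eQ /eqP eC]; rewrite (sum_shift_invariant _ eC) //.
  by case/setD1P: eQ.
have zQ : 0 \in Q by apply/imphiP; exists 0; rewrite /phi expr0n addr0.
have <- : #|Q :\ 0| = (2 ^ n).-1 by rewrite -cQ (cardsD1 0 Q) zQ.
rewrite -sum_nat_const; apply: eq_bigr => e eQ0; have /setD1P[e0 eQ] := eQ0.
rewrite sum1_card.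
transitivity #|[set C : {set F} |
    [&& C \subset Q, #|C| == (3 * 2)%N & shift e C == C]]|.
  apply: eq_card => C; rewrite [RHS]inE andbA; apply/andP/andP => [[]|].
    case/setIdP=> Csix /existsP[e' /andP[eQ' /eqP eC']] /eqP sC.
    move: (Csix); rewrite inE => /andP[-> /eqP cC]; rewrite cC; split=> //.
    have /setD1P[e0' _] := eQ'.
    by rewrite -sC (sum_shift_invariant e0' eC' cC) eC'.
  case=> CQ /eqP eC; split; last first.
    by rewrite (sum_shift_invariant e0 eC) //; case/andP: CQ => _ /eqP.
  apply/setIdP; split; first by rewrite inE.
  by apply/existsP; exists e; rewrite eQ0 eC eqxx.
rewrite card_shift_invariant ?shift_imphi //; congr 'C(_, 3).
have := card_psi e0 (shift_imphi eQ); rewrite cQ.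
case: (n) => [|n']; last by rewrite expnSr => /eqP; rewrite eqn_mul2r => /eqP.
by case: #|_| => [|[]].
Qed.

Definition translates (R : {set F}) :=
  [set C in sixsets | [exists d, C == shift d R]].

(** If x + w is in imphi for all x in R, then the translates of R inside imphi are
    those by the elements of the coset imphi + w, because imphi is a group; they
    are distinct because no nonzero shift preserves R. *)
Lemma card_translates (R : {set F}) w : #|R| = 6%N ->
  (forall e, shift e R = R -> e = 0) -> (forall x, x \in R -> x + w \in Q) ->
  #|translates R| = #|Q|.
Proof.
move=> cR rigid Rw.
have addK (a b : F) : a + b + b = a by rewrite -addrA addrr_pchar2 // addr0.
have inj : injective (fun v => shift (v + w) R).
  move=> a b /= /(congr1 (shift (b + w))); rewrite shiftK // shiftD => /rigid.
  have -> : b + w + (a + w) = a + b by ring2 F2.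
  by move/eqP; rewrite -eq_addr_pchar2 // => /eqP.
rewrite -(card_imset _ inj); apply: eq_card => C; apply/idP/imsetP.
  case/setIdP; rewrite inE => /andP[sC _] /existsP[d /eqP eC].
  have [x xR] : exists x, x \in R by apply/set0Pn; rewrite -card_gt0 cR.
  exists (d + w); last by rewrite addK.
  have -> : d + w = (x + d) + (x + w) by ring2 F2.
  by apply: imphiD; rewrite ?Rw // (subsetP sC) // eC inE addK.
case=> v vQ ->; apply/setIdP; split; last by apply/existsP; exists (v + w).
rewrite inE card_shift // cR eqxx andbT; apply/subsetP=> x; rewrite inE => /Rw.
by rewrite addrA addK => xv; rewrite -[x](addK _ v) imphiD.
Qed.

(** Applied to differences of two sextics with the same terms of degree 6, 5
    and 3. *)
Lemma quartic_zero (R : {set F}) a0 a1 a2 a4 : #|R| = 6%N ->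
  (forall x, x \in R -> a4 * x ^+ 4 + a2 * x ^+ 2 + a1 * x + a0 = 0) ->
  a2 = 0 /\ a4 = 0.
Proof.
move=> cR zero; pose p := Poly [:: a0; a1; a2; 0; a4].
suff p0 : p = 0.
  split; [have := coef_Poly [:: a0; a1; a2; 0; a4] 2
         | have := coef_Poly [:: a0; a1; a2; 0; a4] 4];
  by rewrite -/p p0 coef0 => /= <-.
apply/eqP; apply/negPn/negP => p0.
suff : (#|R| <= 4)%N by rewrite cR.
apply: (card_roots_le p0); first exact: size_Poly.
by move=> x /zero <-; rewrite horner_Poly /=; ring.
Qed.

Lemma mem_fib_roots11_0 x : x \in 0 |: fib_roots F 11 ->
  x ^+ 6 + x ^+ 5 + x ^+ 4 + x ^+ 2 + x = 0.
Proof.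
rewrite !inE fib11 // => /orP[/eqP ->|/eqP e]; first by rewrite !expr0n !addr0.
by rewrite -[RHS](mulr0 x) -e; ring.
Qed.

Lemma mem_fib_roots13 x :
  x \in fib_roots F 13 -> x ^+ 6 + x ^+ 5 + x ^+ 2 + x + 1 = 0.
Proof. by rewrite inE fib13 // => /eqP. Qed.

Lemma expf4_eq0 (e : F) : e ^+ 4 = 0 -> e = 0.
Proof. by move/eqP; rewrite expf_eq0 => /eqP. Qed.

(** The polynomial fib (x + e) 13 - fib x 13 has degree at most 4 and vanishes at
    six points; its coefficient at x^2 is e^4. *)
Lemma fib_roots13_rigid e : #|fib_roots F 13| = 6%N ->
  shift e (fib_roots F 13) = fib_roots F 13 -> e = 0.
Proof.
move=> cR eR; apply: expf4_eq0.
apply: (proj1 (@quartic_zero _ (e ^+ 6 + e ^+ 5 + e ^+ 2 + e)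
  (e ^+ 4) (e ^+ 4) (e ^+ 2 + e) cR _)).
move=> x xR; have := mem_fib_roots13 xR; rewrite -eR inE in xR.
have := mem_fib_roots13 xR => e1 e2; rewrite -[RHS](addr0 0) -{1}e1 -e2.
by ring2 F2.
Qed.

(** The same comparison as in [fib_roots13_rigid], for x * fib x 11. *)
Lemma fib_roots11_rigid e : #|0 |: fib_roots F 11| = 6%N ->
  shift e (0 |: fib_roots F 11) = 0 |: fib_roots F 11 -> e = 0.
Proof.
move=> cR eR; apply: expf4_eq0.
apply: (proj1 (@quartic_zero _ (e ^+ 6 + e ^+ 5 + e ^+ 4 + e ^+ 2 + e)
  (e ^+ 4) (e ^+ 4) (e ^+ 2 + e) cR _)).
move=> x xR; have := mem_fib_roots11_0 xR; rewrite -eR in_set in xR.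
have := mem_fib_roots11_0 xR => e1 e2; rewrite -[RHS](addr0 0) -{1}e1 -e2.
by ring2 F2.
Qed.

(** Comparing the coefficients of (x + e) * fib (x + e) 11 and fib x 13 at x^2
    gives e = 0, but then those at x^4 differ. *)
Lemma fib_roots13_not_roots11 e : #|fib_roots F 13| = 6%N ->
  shift e (0 |: fib_roots F 11) <> fib_roots F 13.
Proof.
move=> cR eR.
have [|e4 e1] := @quartic_zero _ (e ^+ 6 + e ^+ 5 + e ^+ 4 + e ^+ 2 + e + 1)
  (e ^+ 4) (e ^+ 4) (e ^+ 2 + e + 1) cR.
  move=> x xR; have := mem_fib_roots13 xR; rewrite -eR in_set in xR.
  have := mem_fib_roots11_0 xR => e1 e2; rewrite -[RHS](addr0 0) -{1}e1 -e2.
  by ring2 F2.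
by move: e1; rewrite (expf4_eq0 e4) expr0n !add0r => /eqP; rewrite oner_eq0.
Qed.

End Counting.

(** * The orbit equation and its solution *)

Section Total.

Variables (F : finFieldType) (F2 : 2 \in [pchar F]).
Variables (n : nat) (cardF : #|F| = (2 ^ n)%N).
Local Notation Q := (imphi F).

Lemma card_translates13 :
  #|translates (fib_roots F 13)| = ((6 %| n) * #|Q|)%N.
Proof.
have [n6|n6] := boolP (6 %| n)%N.
  have [w cR Rw] := fib_roots13_full F2 cardF n6.
  by rewrite mul1n (card_translates F2 cR _ Rw) // => e; apply: fib_roots13_rigid.
rewrite mul0n; apply: eq_card0 => C; apply/setIdP=> -[].
rewrite inE => /andP[_ /eqP cC] /existsP[d /eqP eC].
have [w wR] : exists w, w \in fib_roots F 13.
  by apply/set0Pn; rewrite -card_gt0 -(card_shift F2 d) -eC cC.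
by rewrite (fib_roots13_dvd F2 cardF wR) in n6.
Qed.

(** If x + w is in imphi for all x in R, then the translates of R inside imphi are
    those by the elements of the coset imphi + w, because imphi is a group; they
    are distinct because no nonzero shift preserves R. *)
Lemma card_translates11 :
  #|translates (0 |: fib_roots F 11)| = ((10 %| n) * #|Q|)%N.
Proof.
have [n10|n10] := boolP (10 %| n)%N.
  have [cR /subsetP RQ] := fib_roots11_full F2 cardF n10.
  rewrite mul1n (@card_translates _ F2 _ 0) // => [e|x xR].
    exact: fib_roots11_rigid.
  by rewrite addr0 RQ.
rewrite mul0n; apply: eq_card0 => C; apply/setIdP=> -[].
rewrite inE => /andP[sC /eqP cC] /existsP[d /eqP eC].
have cR : #|0 |: fib_roots F 11| = 6%N by rewrite -(card_shift F2 d) -eC.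
have [w wR] : exists w, w \in fib_roots F 11.
  apply/set0Pn; rewrite -card_gt0; move: cR; rewrite cardsU1.
  by case: (0 \notin _); case: #|_|.
have dQ : d \in Q.
  by apply: (subsetP sC); rewrite eC !inE addrr_pchar2 ?eqxx.
have wdQ : w + d \in Q.
  apply: (subsetP sC); rewrite eC inE -addrA addrr_pchar2 // addr0.
  by rewrite setU1r.
have wQ : w \in Q by rewrite -[w]addr0 -(addrr_pchar2 F2 d) addrA imphiD.
by rewrite (fib_roots11_dvd F2 cardF wR wQ) in n10.
Qed.

Lemma has_symmetry_disjoint (C : {set F}) : C \in sixsets F ->
  (has_symmetry C : nat) = ([exists e in Q :\ 0%R, shift e C == C] +
    [exists d, C == shift d (fib_roots F 13)] +
    [exists d, C == shift d (0%R |: fib_roots F 11)])%N.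
Proof.
rewrite inE /has_symmetry => /andP[sC /eqP cC].
have [/existsP[d /eqP eC]|_] := boolP [exists d, C == shift d (fib_roots F 13)].
  have cR : #|fib_roots F 13| = 6%N by rewrite -(card_shift F2 d) -eC.
  have -> : [exists e in Q :\ 0, shift e C == C] = false.
    apply/existsP=> -[e /andP[/setD1P[e0 _] /eqP]]; rewrite eC shiftD addrC -shiftD.
    move/(can_inj (shiftK F2 d))/(fib_roots13_rigid F2 cR)/eqP.
    by rewrite (negPf e0).
  have -> // : [exists d, C == shift d (0 |: fib_roots F 11)] = false.
  apply/existsP=> -[d' /eqP]; rewrite eC => /(congr1 (shift d)).
  by rewrite (shiftK F2) shiftD => /esym; apply: fib_roots13_not_roots11.
have [/existsP[d /eqP eC]|_] :=
  boolP [exists d, C == shift d (0 |: fib_roots F 11)].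
  have cR : #|0 |: fib_roots F 11| = 6%N by rewrite -(card_shift F2 d) -eC.
  have -> // : [exists e in Q :\ 0, shift e C == C] = false.
  apply/existsP=> -[e /andP[/setD1P[e0 _] /eqP]]; rewrite eC shiftD addrC -shiftD.
  move/(can_inj (shiftK F2 d))/(fib_roots11_rigid F2 cR)/eqP.
  by rewrite (negPf e0).
by rewrite !orbF !addn0.
Qed.

Lemma blocks13_count :
  (#|blocks13 F| + #|invariant_sixsets F| + ((6 %| n) + (10 %| n)) * #|Q| =
   'C(#|Q|, 6))%N.
Proof.
rewrite mulnDl -card_translates13 -card_translates11 -card_sixsets blocks13_card //.
have card_sub (P : pred {set F}) :
    #|[set C in sixsets F | P C]| = (\sum_(C in sixsets F) P C)%N.
  rewrite -sum1_card big_mkcond /= [RHS]big_mkcond /=.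
  by apply: eq_bigr => C _; rewrite inE; case: (C \in _); case: (P C).
have -> : #|[set C : {set F} | [&& C \subset Q, #|C| == 6%N & ~~ has_symmetry C]]| =
    (\sum_(C in sixsets F) ~~ has_symmetry C)%N.
  by rewrite -card_sub; apply: eq_card => C; rewrite !inE andbA.
rewrite !card_sub -!big_split /= -sum1_card; apply: eq_bigr => C Csix.
rewrite -addnA [X in (_ + X)%N]addnA -has_symmetry_disjoint //.
by case: (has_symmetry C).
Qed.

End Total.

(** If k > m, then both sides are 0, one of the factors being m - m. *)
Lemma natr_ffact (R : pzRingType) (m k : nat) :
  (m ^_ k)%:R = \prod_(i < k) (m%:R - i%:R) :> R.
Proof.
elim: k => [|k IH]; first by rewrite ffactn0 big_ord0.
rewrite big_ord_recr /= -IH ffactnSr natrM.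
have [le_km|lt_mk] := leqP k m; first by rewrite natrB.
by rewrite ffact_small // !mul0r.
Qed.

Lemma natr_bin (k m : nat) :
  ('C(m, k))%:R = (\prod_(i < k) (m%:R - i%:R)) / (k`!)%:R :> rat.
Proof.
by rewrite -natr_ffact -bin_ffact natrM mulfK // pnatr_eq0 -lt0n fact_gt0.
Qed.

Lemma residue60 n :
  ((n %% 60)%N \in [:: 6; 10; 12; 18; 20; 24; 36; 40; 42; 48; 50; 54]%N) =
    (6 %| n)%N (+) (10 %| n)%N /\
  ((n %% 60)%N \in [:: 0; 30]%N) = (6 %| n)%N && (10 %| n)%N.
Proof.
have mod60 d : (d %| 60)%N -> (d %| n)%N = (d %| n %% 60)%N.
  by move=> d60; rewrite {1}(divn_eq n 60) dvdn_addr // dvdn_mull.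
rewrite !mod60 //; have := ltn_pmod n (isT : 0 < 60)%N.
move: (n %% 60)%N => s s60; have: s \in iota 0 60 by rewrite mem_iota.
have /allP check : all (fun s =>
    ((s \in [:: 6; 10; 12; 18; 20; 24; 36; 40; 42; 48; 50; 54]%N) ==
      (6 %| s)%N (+) (10 %| s)%N) &&
    ((s \in [:: 0; 30]%N) == (6 %| s)%N && (10 %| s)%N)) (iota 0 60) by [].
by move=> /check /andP[/eqP-> /eqP->].
Qed.

(** The 6-subsets of imphi, sorted into those whose block has stabilizer <t>, those
    invariant under a shift, and the translates of the two root sets. *)
Lemma orbit_equation (F : finFieldType) n : #|F| = (2 ^ n.+1)%N ->
  (m_ F 858 * 2 ^ n + (2 ^ n).-1 * 'C(2 ^ n.-1, 3) +
   ((6 %| n.+1) + (10 %| n.+1)) * 2 ^ n = 'C(2 ^ n, 6))%N.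
Proof.
move=> cardF; have F2 : 2 \in [pchar F] by apply: (card_finPcharP cardF).
have cQ : #|imphi F| = (2 ^ n)%N.
  by apply/eqP; rewrite -(eqn_pmul2r (isT : 0 < 2)%N) card_imphi // cardF expnSr.
move: (m_ F 858) (design_orbits_blocks F2) => m; rewrite cardF expnS mulnCA => /eqP.
rewrite eqn_pmul2l // => /eqP mN.
by have := blocks13_count F2 cardF; rewrite (card_invariant_sixsets F2 cQ) cQ -mN.
Qed.

(** The denominator is a parameter, so that 23040 can be replaced by 32 * 720
    before any computation. *)
Definition W_over (k n : nat) : rat := let q : rat := 2 ^+ n in
  1 / k%:R * q * (q - 2) * (q - 4) * (q - 8) * (q - 16).

Lemma W_denominator n : exists2 k : nat, W n = W_over k n & k = (32 * 720)%N.
Proof. eexists; [unfold W, W_over; reflexivity | by vm_compute]. Qed.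

(** Here u stands for #|F| / 4. *)
Lemma orbit_identity (K : numFieldType) (u m a b : K) : u != 0 ->
  m * (2 * u) + (2 * u - 1) * (1 * (u - 0) * (u - 1) * (u - 2) / 6) +
    (a + b) * (2 * u) =
  1 * (2 * u - 0) * (2 * u - 1) * (2 * u - 2) * (2 * u - 3) * (2 * u - 4) *
    (2 * u - 5) / 720 ->
  m = 1 / (32 * 720) * (2 * (2 * u)) * (2 * (2 * u) - 2) * (2 * (2 * u) - 4) *
    (2 * (2 * u) - 8) * (2 * (2 * u) - 16) - a - b.
Proof.
move=> u0 /(canRL (addrK _))/(canRL (addrK _)) E.
have u20 : 2 * u != 0 by rewrite mulf_neq0 ?pnatr_eq0.
by apply: (mulIf u20); rewrite {}E; field.
Qed.

Lemma solve_orbit_equation n m a b :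
  (m * 2 ^ n + (2 ^ n).-1 * 'C(2 ^ n.-1, 3) + (a + b) * 2 ^ n = 'C(2 ^ n, 6))%N ->
  m%:R = W n.+1 - a%:R - b%:R :> rat.
Proof.
have [k -> ->] := W_denominator n.+1; rewrite /W_over natrM.
case: n => [|n].
  rewrite expn0 mul0n addn0 !muln1 bin_small // => /eqP.
  rewrite !addn_eq0 => /and3P[/eqP-> /eqP-> /eqP->].
  by rewrite expr1 subrr.
rewrite -pred_Sn; have u0 : (2 ^ n)%:R != 0 :> rat by rewrite pnatr_eq0 expn_eq0.
move/(congr1 (fun k : nat => k%:R : rat)).
rewrite !natrD !natrM !natr_bin -subn1 natrB ?expn_gt0 // natrD.
rewrite !exprS -!natrX expnS natrM.
rewrite !big_ord_recr !big_ord0 /=.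
move: u0; move: ((2 ^ n)%:R : rat) => u u0.
have -> : (6`! = 720)%N by [].
have -> : (3`! = 6)%N by [].
exact: orbit_identity.
Qed.

Theorem proposition5p24 (F : finFieldType) (n : nat)
    (n_ge1 : (1 <= n)%N) (cardF : #|F| = (2 ^ n)%N) :
  (m_ F 858)%:R =
    (if (n %% 60)%N \in [:: 6; 10; 12; 18; 20; 24; 36; 40; 42; 48; 50; 54]%N
     then W n - 1
     else if (n %% 60)%N \in [:: 0; 30]%N then W n - 2
     else W n) :> rat.
Proof.
have Wm : (m_ F 858)%:R = W n - (6 %| n)%N%:R - (10 %| n)%N%:R :> rat.
  rewrite -(prednK n_ge1) in cardF *.
  exact: solve_orbit_equation (orbit_equation cardF).
rewrite {}Wm; have [-> ->] := residue60 n; move: (W n) => x.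
by case: (6 %| n)%N; case: (10 %| n)%N; rewrite /= ?subr0 //; ring.
Qed.
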